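(* Let $c\in\{0,1,2,\dots\}$ and put $M_c=\sqrt{c^2+1}-c$. If $0<M<M_c$ and $f\in S_M$, then $\mathcal{B}_c(f)$ is convex, i.e. $\mathcal{B}_c(f)\in K$. Hence $\mathcal{B}_c(S_{M_c})\subset K$.
   Context: $\mathbb{D}$ is the open unit disk in $\mathbb{C}$, $\mathcal{H}(\mathbb{D})$ is the class of functions analytic in $\mathbb{D}$, and $\mathcal{H}_0(\mathbb{D})$ is the set of $f\in\mathcal{H}(\mathbb{D})$ with $f(0)=0$ and $f'(0)=1$. For $0<M\le 1$, $$S_M=\left\{f\in\mathcal{H}_0(\mathbb{D}):\ \left|\frac{zf'(z)}{f(z)}-1\right|<M \text{ for all } z\in\mathbb{D}\right\},$$ where $zf'(z)/f(z)$ is understood to be analytic in $\mathbb{D}$ (with value $1$ at $z=0$; in particular $f\neq 0$ on $\mathbb{D}\setminus\{0\}$). $K$ is the class of (univalent) convex functions: those univalent $f\in\mathcal{H}_0(\mathbb{D})$ with $\operatorname{Re}\left\{1+\frac{zf''(z)}{f'(z)}\right\}>0$ for all $z\in\mathbb{D}$. The Bernardi transform of $f\in\mathcal{H}_0(\mathbb{D})$ is $$\mathcal{B}_c(f)(z)=\frac{1+c}{z^c}\int_0^z \zeta^{c-1}f(\zeta)\,d\zeta,$$ extended analytically to $z=0$ with value $0$. *)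

(* Defs.v *)
From Stdlib Require Export Reals.
From Coquelicot Require Export Coquelicot.

Open Scope R_scope.

Definition unit_disk (z : C) : Prop := Cmod z < 1.

(* Functions on the disk are total functions [C -> C]; every condition below
   only involves their values on the disk.  Analytic means complex
   differentiable at each point of the (open) disk. *)
Definition analytic_disk (f : C -> C) : Prop :=
  forall z : C, unit_disk z -> ex_derive (K := C_AbsRing) (V := C_NormedModule) f z.

(* [C_derive f z] is the complex derivative only where [f] is complex
   differentiable (it is computed along the real direction), so it is always
   used together with [analytic_disk f]. *)
Definition class_H0 (f : C -> C) : Prop :=
  analytic_disk f /\ f (RtoC 0) = RtoC 0 /\ C_derive f (RtoC 0) = RtoC 1.

Definition starlike_quotient (f : C -> C) (z : C) : C :=
  if Ceq_dec z (RtoC 0) then RtoC 1 else (z * C_derive f z / f z)%C.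

Definition class_S (M : R) (f : C -> C) : Prop :=
  class_H0 f /\
  (forall z : C, unit_disk z -> z <> RtoC 0 -> f z <> RtoC 0) /\
  (forall z : C, unit_disk z -> Cmod (starlike_quotient f z - RtoC 1)%C < M).

Definition univalent_disk (f : C -> C) : Prop :=
  forall z w : C, unit_disk z -> unit_disk w -> f z = f w -> z = w.

(* Univalence already forces f' <> 0 on the disk; the clause is spelled out so
   that the quotient never relies on the convention for division by zero. *)
Definition class_K (f : C -> C) : Prop :=
  class_H0 f /\
  univalent_disk f /\
  (forall z : C, unit_disk z ->
     C_derive f z <> RtoC 0 /\
     0 < Re (RtoC 1 + z * C_derive (C_derive f) z / C_derive f z)%C).

(* Integral of [g] along the segment from 0 to [z], parametrized by
   zeta = t z with 0 <= t <= 1. *)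
Definition segment_integral (g : C -> C) (z : C) : C :=
  RInt (V := C_R_CompleteNormedModule) (fun t : R => (g (RtoC t * z) * z)%C) 0 1.

(* zeta ^ (c - 1) is written zeta ^ c / zeta to cover c = 0.  The two sides can
   only differ at zeta = 0, an endpoint of the segment, which does not affect
   the Riemann integral. *)
Definition bernardi (c : nat) (f : C -> C) (z : C) : C :=
  if Ceq_dec z (RtoC 0) then RtoC 0
  else ((RtoC 1 + RtoC (INR c)) / z ^ c *
        segment_integral (fun zeta : C => zeta ^ c / zeta * f zeta) z)%C.

Definition M_bound (c : nat) : R := sqrt (INR c ^ 2 + 1) - INR c.

(* Main.v *)
Require Import Defs.
From Stdlib Require Import Lra Lia Psatz Classical ClassicalEpsilon.

(** Put [F = B_c(f)], [p = z f' / f] and [P = z F' / F].  Then [c F + z F' = (1 + c) f], whence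
    [z P' = (c + P) (p - P)] and [1 + z F'' / F' = p (c + P) / P - c].

    - [|P - 1| < M]: otherwise take a point [z] of least modulus with [|P - 1| = M]; moving from
      it in the direction [- z conj (c + P)] decreases [|z|] but, as [|p - 1| < M], increases
      [|P - 1|].
    - [|p - 1| < M] and [|P - 1| < M] force [Re (p (c + P) / P - c) > 0] precisely when
      [M^2 + 2 c M <= 1], that is [M <= M_c].
    - [s |-> log F(e^s)] is the identity plus a [2 i pi]-periodic map with derivative [P - 1] of
      modulus [< 1], so it is injective and [F] is univalent.

    That [F] is differentiable at all rests on Goursat's theorem, because [f'] is not assumed
    continuous. *)

(** * Complex differentiability *)

(** For [c = 0] the integrand is [f(z) / z], which is known to be continuous at [0] but not yet
    differentiable there. Goursat's theorem is therefore applied only on sets that miss the origin,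
    and the origin is reached by a limit; [F'(0)] is estimated by hand. Likewise [F''] is read off
    [c F + z F' = (1 + c) f], which expresses [F'] through functions already known to be
    differentiable. The point of least modulus does the work of a maximum principle. The condition
    there is kept in product form, because [F <> 0] off the origin is itself one of its
    consequences. No branch of the logarithm is chosen. The increment of [log (F(z) / z)] along a
    spiral from [z] to [z e^d] is an integral that could depend on [d] itself; shrinking the spiral
    to the origin shows that it depends on [e^d] only. If [F] takes the same value at both ends,
    this allows [d] to be chosen as minus its own increment, which is impossible for [d <> 0] since
    the increment is shorter than [d]. *)

Notation is_Cderive := (is_derive (K := C_AbsRing) (V := C_NormedModule)).
Notation Ccontinuous := (continuous (T := C_UniformSpace) (U := C_UniformSpace)).

Lemma Cmod_sqr (z : C) : Cmod z * Cmod z = Re z * Re z + Im z * Im z.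
Proof. generalize (Cmod2_alt z); simpl; intros H; nra. Qed.

Lemma C_eq (z w : C) : Re z = Re w -> Im z = Im w -> z = w.
Proof. destruct z, w; simpl; intros; now subst. Qed.

Lemma im_le_Cmod (z : C) : Rabs (Im z) <= Cmod z.
Proof. eapply Rle_trans; [apply Rmax_r | apply Rmax_Cmod]. Qed.

Lemma Cmod_le_sum (z : C) : Cmod z <= Rabs (Re z) + Rabs (Im z).
Proof.
generalize (Cmod_sqr z) (Cmod_ge_0 z) (Rabs_pos (Re z)) (Rabs_pos (Im z)).
generalize (Rsqr_abs (Re z)) (Rsqr_abs (Im z)); unfold Rsqr; intros; nra.
Qed.

Lemma Cmod_minus_sym (z w : C) : Cmod (z - w) = Cmod (w - z).
Proof. rewrite <- Cmod_opp; f_equal; ring. Qed.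

Lemma Cmod_triangle_rev (z w : C) : Cmod z - Cmod w <= Cmod (z - w).
Proof.
generalize (Cmod_triangle (z - w) w).
replace (z - w + w)%C with z by ring; lra.
Qed.

Lemma Cmod_minus_triangle (z w v : C) : Cmod (z - v) <= Cmod (z - w) + Cmod (w - v).
Proof. replace (z - v)%C with ((z - w) + (w - v))%C by ring; apply Cmod_triangle. Qed.

Lemma Cmod_pos_real (x : R) : 0 <= x -> Cmod (RtoC x) = x.
Proof. intros; rewrite Cmod_R; now apply Rabs_pos_eq. Qed.

(** Balls of [C_UniformSpace] are squares and those of [Cmod] are discs; a square of half-side
    [d / 2] fits in the disc of radius [d]. *)
Lemma Clocally (z : C) (P : C -> Prop) :
  locally (T := C_UniformSpace) z P <->
  exists d, 0 < d /\ forall w, Cmod (w - z) < d -> P w.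
Proof.
split.
- intros [d Hd]; exists d; split; [apply cond_pos|].
  intros w Hw; apply Hd; now apply C_NormedModule_mixin_compat1.
- intros [d [Hd H]].
  assert (H2 : 0 < d / 2) by lra.
  exists (mkposreal _ H2); intros w [Hw1 Hw2]; apply H.
  eapply Rle_lt_trans; [apply Cmod_le_sum|].
  change (Rabs (Re w - Re z) < d / 2) in Hw1.
  change (Rabs (Im w - Im z) < d / 2) in Hw2.
  change (Rabs (Re w - Re z) + Rabs (Im w - Im z) < d); lra.
Qed.

Lemma Ccontinuous_eps (f : C -> C) (z : C) :
  Ccontinuous f z <->
  forall e, 0 < e -> exists d, 0 < d /\
    forall w, Cmod (w - z) < d -> Cmod (f w - f z) < e.
Proof.
split.
- intros H e He.
  apply Clocally.
  apply (H (fun y => Cmod (y - f z) < e)).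
  apply Clocally; exists e; now split.
- intros H P HP.
  apply Clocally in HP; destruct HP as [e [He HP]].
  destruct (H e He) as [d [Hd Hf]].
  apply Clocally; exists d; split; trivial; intros w Hw; now apply HP, Hf.
Qed.

(** [is_derive] takes its neighbourhoods in the uniform structure of the ring, whose balls are
    [Cmod] discs, whereas [Ccontinuous] uses the product structure. *)
Lemma Clocally_AbsRing (z : C) (P : C -> Prop) :
  locally (T := AbsRing_UniformSpace C_AbsRing) z P <->
  exists d, 0 < d /\ forall w, Cmod (w - z) < d -> P w.
Proof.
split.
- intros [d Hd]; exists d; split; [apply cond_pos|]; exact Hd.
- intros [d [Hd H]]; exists (mkposreal d Hd); exact H.
Qed.

Lemma is_Cderive_eps (f : C -> C) (z l : C) :
  is_Cderive f z l <->
  forall e, 0 < e -> exists d, 0 < d /\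
    forall w, Cmod (w - z) < d -> Cmod (f w - f z - l * (w - z)) <= e * Cmod (w - z).
Proof.
split.
- intros [_ H] e He.
  specialize (H z (fun P HP => HP) (mkposreal e He)).
  apply Clocally_AbsRing in H; destruct H as [d [Hd H]].
  exists d; split; trivial; intros w Hw.
  rewrite (Cmult_comm l); exact (H w Hw).
- intros H; split; [apply is_linear_scal_l|].
  intros x Hx e.
  apply (is_filter_lim_locally_unique (K := C_AbsRing)
          (V := AbsRing_NormedModule C_AbsRing) z x) in Hx; subst x.
  destruct (H e (cond_pos e)) as [d [Hd Hf]].
  apply Clocally_AbsRing; exists d; split; trivial; intros w Hw.
  specialize (Hf w Hw); rewrite (Cmult_comm l) in Hf; exact Hf.
Qed.

Lemma is_Cderive_continuous (f : C -> C) (z l : C) : is_Cderive f z l -> Ccontinuous f z.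
Proof.
intros H; rewrite is_Cderive_eps in H; apply Ccontinuous_eps; intros e He.
destruct (H 1 Rlt_0_1) as [d [Hd Hf]].
assert (Hl := Cmod_ge_0 l).
exists (Rmin d (e / (Cmod l + 1))); split.
{ apply Rmin_pos; trivial; apply Rdiv_lt_0_compat; lra. }
intros w Hw.
assert (H1 := Rlt_le_trans _ _ _ Hw (Rmin_l _ _)).
assert (H2 := Rlt_le_trans _ _ _ Hw (Rmin_r _ _)).
apply (Rmult_lt_compat_r (Cmod l + 1)) in H2; [|lra].
replace (e / (Cmod l + 1) * (Cmod l + 1)) with e in H2 by (field; lra).
specialize (Hf w H1).
replace (f w - f z)%C with ((f w - f z - l * (w - z)) + l * (w - z))%C by ring.
eapply Rle_lt_trans; [apply Cmod_triangle|]; rewrite Cmod_mult; lra.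
Qed.

Lemma is_Cderive_inv (z : C) : z <> RtoC 0 -> is_Cderive Cinv z (- / (z * z))%C.
Proof.
intros Hz; apply is_Cderive_eps; intros e He.
assert (Hm := proj1 (Cmod_gt_0 z) Hz).
set (m := Cmod z) in *.
assert (Hm2 : 0 < m * m) by now apply Rmult_lt_0_compat.
assert (Hm3 : 0 < m * m * m) by now apply Rmult_lt_0_compat.
(* The remainder is [(w - z)^2 / (z^2 w)]; once [|w| > m / 2], the factor [1 / |z^2 w|] is below
   [2 / m^3]. *)
exists (Rmin (m / 2) (e * (m * m * m / 2))); split.
{ apply Rmin_pos; [lra|]; apply Rmult_lt_0_compat; lra. }
intros w Hw.
assert (H1 := Rlt_le_trans _ _ _ Hw (Rmin_l _ _)).
assert (H2 := Rlt_le_trans _ _ _ Hw (Rmin_r _ _)).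
assert (H3 : m / 2 < Cmod w).
{ generalize (Cmod_triangle_rev z w); rewrite Cmod_minus_sym; fold m; lra. }
assert (Hw0 : w <> RtoC 0) by (apply Cmod_gt_0; lra).
replace (/ w - / z - - / (z * z) * (w - z))%C
  with ((w - z) / (z * z * w) * (w - z))%C by (field; split; assumption).
rewrite Cmod_mult; apply Rmult_le_compat_r; [apply Cmod_ge_0|].
rewrite Cmod_div by (repeat apply Cmult_neq_0; assumption).
rewrite !Cmod_mult; fold m.
apply Rle_div_l; [nra|].
apply Rlt_le, Rlt_le_trans with (1 := H2).
apply Rmult_le_compat_l; [lra|]; nra.
Qed.

Lemma is_Cderive_const (a z : C) : is_Cderive (fun _ => a) z (RtoC 0).
Proof. apply (is_derive_const (K := C_AbsRing) (V := C_NormedModule)). Qed.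

Lemma is_Cderive_id (z : C) : is_Cderive (fun x => x) z (RtoC 1).
Proof.
apply is_Cderive_eps; intros e He; exists 1; split; [lra|]; intros w _.
replace (w - z - 1 * (w - z))%C with (RtoC 0) by ring.
rewrite Cmod_0; apply Rmult_le_pos; [lra | apply Cmod_ge_0].
Qed.

Lemma is_Cderive_plus (f g : C -> C) (z a b : C) :
  is_Cderive f z a -> is_Cderive g z b -> is_Cderive (fun x => f x + g x)%C z (a + b)%C.
Proof. apply (is_derive_plus (K := C_AbsRing) (V := C_NormedModule)). Qed.

Lemma is_Cderive_minus (f g : C -> C) (z a b : C) :
  is_Cderive f z a -> is_Cderive g z b -> is_Cderive (fun x => f x - g x)%C z (a - b)%C.
Proof. apply (is_derive_minus (K := C_AbsRing) (V := C_NormedModule)). Qed.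

Lemma is_Cderive_mult (f g : C -> C) (z a b : C) :
  is_Cderive f z a -> is_Cderive g z b ->
  is_Cderive (fun x => f x * g x)%C z (a * g z + f z * b)%C.
Proof.
intros Hf Hg.
(* The product rule is stated for values in the ring as a module over itself. Both module structures
   have the same norm, so the little-o component converts. *)
assert (conv : forall h l, is_Cderive h z l ->
  is_derive (K := C_AbsRing) (V := AbsRing_NormedModule C_AbsRing) h z l).
{ intros h l Hh; split; [apply is_linear_scal_l | exact (proj2 Hh)]. }
assert (H := is_derive_mult (K := C_AbsRing) f g z a b (conv _ _ Hf) (conv _ _ Hg) Cmult_comm).
split; [apply is_linear_scal_l | exact (proj2 H)].
Qed.

Lemma is_Cderive_comp (f g : C -> C) (z a b : C) :
  is_Cderive f (g z) a -> is_Cderive g z b -> is_Cderive (fun x => f (g x)) z (b * a)%C.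
Proof.
intros Hf Hg; apply (is_derive_comp (K := C_AbsRing) (V := C_NormedModule)); trivial.
split; [apply is_linear_scal_l | exact (proj2 Hg)].
Qed.

Lemma is_Cderive_eq (f : C -> C) (z a b : C) : is_Cderive f z a -> a = b -> is_Cderive f z b.
Proof. now intros H <-. Qed.

Lemma is_Cderive_div (f g : C -> C) (z a b : C) :
  g z <> RtoC 0 -> is_Cderive f z a -> is_Cderive g z b ->
  is_Cderive (fun x => f x / g x)%C z ((a * g z - f z * b) / (g z * g z))%C.
Proof.
intros H0 Hf Hg.
eapply is_Cderive_eq.
- apply is_Cderive_mult; [exact Hf|].
  apply is_Cderive_comp; [now apply is_Cderive_inv | exact Hg].
- simpl; field; trivial.
Qed.

Lemma is_Cderive_pow (n : nat) (z : C) :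
  z <> RtoC 0 -> is_Cderive (fun x => x ^ n)%C z (RtoC (INR n) * (z ^ n / z))%C.
Proof.
intros H; induction n.
- eapply is_Cderive_eq; [exact (is_Cderive_const 1 z)|]; simpl; field; trivial.
- eapply is_Cderive_eq; [exact (is_Cderive_mult _ _ _ _ _ (is_Cderive_id z) IHn)|].
  rewrite S_INR, RtoC_plus; simpl; field; trivial.
Qed.

Lemma is_Cderive_ext_loc (f g : C -> C) (z l : C) (d : R) :
  0 < d -> (forall w, Cmod (w - z) < d -> f w = g w) -> is_Cderive f z l -> is_Cderive g z l.
Proof.
intros Hd H; apply is_derive_ext_loc; apply Clocally_AbsRing; now exists d.
Qed.

(** * Paths and their integrals *)

Notation path_continuous := (continuous (T := R_UniformSpace) (U := C_UniformSpace)).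
Notation is_CRInt := (is_RInt (V := C_R_NormedModule)).
Notation ex_CRInt := (ex_RInt (V := C_R_NormedModule)).
Notation CRInt := (RInt (V := C_R_CompleteNormedModule)).

(** Coordinatewise, so that the real product rule, mean value theorem and fundamental theorem apply
    to each part. *)
Definition path_derive (y : R -> C) (t : R) (d : C) : Prop :=
  is_derive (fun s => Re (y s)) t (Re d) /\ is_derive (fun s => Im (y s)) t (Im d).

Lemma is_derive_R_eps (f : R -> R) (t l : R) :
  is_derive f t l <->
  forall e, 0 < e -> exists d, 0 < d /\
    forall s, Rabs (s - t) < d -> Rabs (f s - f t - l * (s - t)) <= e * Rabs (s - t).
Proof.
split.
- intros [_ H] e He.
  destruct (H t (fun P HP => HP) (mkposreal e He)) as [d Hd].
  exists d; split; [apply cond_pos|]; intros s Hs.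
  rewrite (Rmult_comm l); exact (Hd s Hs).
- intros H; split; [apply is_linear_scal_l|].
  intros x Hx e.
  apply (is_filter_lim_locally_unique t x) in Hx; subst x.
  destruct (H e (cond_pos e)) as [d [Hd Hf]].
  exists (mkposreal d Hd); intros s Hs.
  specialize (Hf s Hs); rewrite (Rmult_comm l) in Hf; exact Hf.
Qed.

Lemma path_derive_eps (y : R -> C) (t : R) (l : C) :
  path_derive y t l <->
  forall e, 0 < e -> exists d, 0 < d /\
    forall s, Rabs (s - t) < d ->
      Cmod (y s - y t - l * RtoC (s - t)) <= e * Rabs (s - t).
Proof.
split.
- intros [H1 H2] e He.
  rewrite is_derive_R_eps in H1, H2.
  assert (He2 : 0 < e / 2) by lra.
  destruct (H1 _ He2) as [d1 [Hd1 H1']], (H2 _ He2) as [d2 [Hd2 H2']].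
  exists (Rmin d1 d2); split; [now apply Rmin_pos|]; intros s Hs.
  specialize (H1' s (Rlt_le_trans _ _ _ Hs (Rmin_l _ _))).
  specialize (H2' s (Rlt_le_trans _ _ _ Hs (Rmin_r _ _))).
  eapply Rle_trans; [apply Cmod_le_sum|].
  replace (Re (y s - y t - l * RtoC (s - t)))
    with (Re (y s) - Re (y t) - Re l * (s - t)) by (unfold Re, Im; simpl; ring).
  replace (Im (y s - y t - l * RtoC (s - t)))
    with (Im (y s) - Im (y t) - Im l * (s - t)) by (unfold Re, Im; simpl; ring).
  lra.
- intros H; split; apply is_derive_R_eps; intros e He;
    destruct (H e He) as [d [Hd Hy]]; exists d; split; trivial; intros s Hs;
    (eapply Rle_trans; [|exact (Hy s Hs)]).
  + eapply Rle_trans; [|apply re_le_Cmod]; right; f_equal; unfold Re, Im; simpl; ring.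
  + eapply Rle_trans; [|apply im_le_Cmod]; right; f_equal; unfold Re, Im; simpl; ring.
Qed.

Lemma path_continuous_eps (y : R -> C) (t : R) :
  path_continuous y t <->
  forall e, 0 < e -> exists d, 0 < d /\
    forall s, Rabs (s - t) < d -> Cmod (y s - y t) < e.
Proof.
split.
- intros H e He.
  destruct (H (fun w => Cmod (w - y t) < e)) as [d Hd].
  { apply Clocally; now exists e. }
  exists d; split; [apply cond_pos | exact Hd].
- intros H P HP.
  apply Clocally in HP; destruct HP as [e [He HP]].
  destruct (H e He) as [d [Hd Hf]].
  exists (mkposreal d Hd); intros s Hs; apply HP, Hf; exact Hs.
Qed.

Lemma path_derive_continuous (y : R -> C) (t : R) (l : C) :
  path_derive y t l -> path_continuous y t.
Proof.
rewrite path_derive_eps; intros H; apply path_continuous_eps; intros e He.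
destruct (H 1 Rlt_0_1) as [d [Hd Hf]].
assert (Hl := Cmod_ge_0 l).
exists (Rmin d (e / (Cmod l + 1))); split.
{ apply Rmin_pos; trivial; apply Rdiv_lt_0_compat; lra. }
intros s Hs.
assert (H1 := Rlt_le_trans _ _ _ Hs (Rmin_l _ _)).
assert (H2 := Rlt_le_trans _ _ _ Hs (Rmin_r _ _)).
apply (Rmult_lt_compat_r (Cmod l + 1)) in H2; [|lra].
replace (e / (Cmod l + 1) * (Cmod l + 1)) with e in H2 by (field; lra).
specialize (Hf s H1).
replace (y s - y t)%C with ((y s - y t - l * RtoC (s - t)) + l * RtoC (s - t))%C by ring.
eapply Rle_lt_trans; [apply Cmod_triangle|]; rewrite Cmod_mult, Cmod_R; lra.
Qed.

Lemma path_derive_eq (y : R -> C) (t : R) (a b : C) : path_derive y t a -> a = b -> path_derive y t b.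
Proof. now intros H <-. Qed.

Lemma path_derive_comp (f : C -> C) (y : R -> C) (t : R) (l d : C) :
  is_Cderive f (y t) l -> path_derive y t d -> path_derive (fun s => f (y s)) t (l * d)%C.
Proof.
intros Hf Hy.
assert (Hc := path_derive_continuous _ _ _ Hy).
rewrite path_continuous_eps in Hc.
rewrite is_Cderive_eps in Hf; rewrite path_derive_eps in Hy |- *.
intros e He.
assert (Hl := Cmod_ge_0 l); assert (Hd := Cmod_ge_0 d).
assert (He1 : 0 < e / (2 * (Cmod d + 1))) by (apply Rdiv_lt_0_compat; lra).
assert (He2 : 0 < e / (2 * (Cmod l + 1))) by (apply Rdiv_lt_0_compat; lra).
destruct (Hf _ He1) as [r1 [Hr1 Hf']].
destruct (Hy _ He2) as [r2 [Hr2 Hy']].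
destruct (Hy 1 Rlt_0_1) as [r3 [Hr3 Hy1]].
destruct (Hc _ Hr1) as [r4 [Hr4 Hc']].
exists (Rmin (Rmin r2 r3) r4); split; [repeat apply Rmin_pos; trivial|].
intros s Hs.
assert (H4 := Rlt_le_trans _ _ _ Hs (Rmin_r _ _)).
assert (H23 := Rlt_le_trans _ _ _ Hs (Rmin_l _ _)).
assert (H2 := Rlt_le_trans _ _ _ H23 (Rmin_l _ _)).
assert (H3 := Rlt_le_trans _ _ _ H23 (Rmin_r _ _)).
specialize (Hy' s H2); specialize (Hy1 s H3); specialize (Hf' _ (Hc' s H4)).
replace (f (y s) - f (y t) - l * d * RtoC (s - t))%C with
  ((f (y s) - f (y t) - l * (y s - y t)) + l * (y s - y t - d * RtoC (s - t)))%C by ring.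
eapply Rle_trans; [apply Cmod_triangle|]; rewrite Cmod_mult.
assert (Hb : Cmod (y s - y t) <= (Cmod d + 1) * Rabs (s - t)).
{ replace (y s - y t)%C with ((y s - y t - d * RtoC (s - t)) + d * RtoC (s - t))%C by ring.
  eapply Rle_trans; [apply Cmod_triangle|]; rewrite Cmod_mult, Cmod_R; lra. }
assert (Hs0 := Rabs_pos (s - t)).
apply Rle_trans with (e / (2 * (Cmod d + 1)) * ((Cmod d + 1) * Rabs (s - t))
   + (Cmod l + 1) * (e / (2 * (Cmod l + 1)) * Rabs (s - t))).
- apply Rplus_le_compat.
  + eapply Rle_trans; [exact Hf'|]; apply Rmult_le_compat_l; lra.
  + apply Rmult_le_compat; try lra; apply Cmod_ge_0.
- right; field; lra.
Qed.

Lemma path_derive_mult (y z : R -> C) (t : R) (a b : C) :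
  path_derive y t a -> path_derive z t b ->
  path_derive (fun s => y s * z s)%C t (a * z t + y t * b)%C.
Proof.
intros [H1 H2] [H3 H4]; split.
- apply is_derive_ext with (fun s => Re (y s) * Re (z s) - Im (y s) * Im (z s)).
  { intros; now rewrite re_mult. }
  replace (Re (a * z t + y t * b)) with
   ((Re a * Re (z t) + Re (y t) * Re b) - (Im a * Im (z t) + Im (y t) * Im b))
    by (rewrite re_plus, !re_mult; ring).
  apply (is_derive_minus (K := R_AbsRing) (V := R_NormedModule)); now apply Derive.is_derive_mult.
- apply is_derive_ext with (fun s => Re (y s) * Im (z s) + Im (y s) * Re (z s)).
  { intros; now rewrite im_mult. }
  replace (Im (a * z t + y t * b)) with
   ((Re a * Im (z t) + Re (y t) * Im b) + (Im a * Re (z t) + Im (y t) * Re b))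
    by (unfold Re, Im; simpl; ring).
  apply (is_derive_plus (K := R_AbsRing) (V := R_NormedModule)); now apply Derive.is_derive_mult.
Qed.

Lemma path_derive_const (a : C) (t : R) : path_derive (fun _ => a) t 0.
Proof. split; apply (is_derive_const (K := R_AbsRing) (V := R_NormedModule)). Qed.

Lemma path_derive_RtoC (f : R -> R) (t d : R) :
  is_derive f t d -> path_derive (fun s => RtoC (f s)) t d.
Proof.
intros H; split; [exact H|].
exact (is_derive_const (K := R_AbsRing) (V := R_NormedModule) 0 t).
Qed.

Lemma path_derive_plus (y z : R -> C) (t : R) (a b : C) :
  path_derive y t a -> path_derive z t b -> path_derive (fun s => y s + z s)%C t (a + b)%C.
Proof.
intros [H1 H2] [H3 H4]; split;
  now apply (is_derive_plus (K := R_AbsRing) (V := R_NormedModule)).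
Qed.

Lemma path_derive_opp (y : R -> C) (t : R) (a : C) :
  path_derive y t a -> path_derive (fun s => - y s)%C t (- a)%C.
Proof.
intros [H1 H2]; split; now apply (is_derive_opp (K := R_AbsRing) (V := R_NormedModule)).
Qed.

Lemma path_derive_Re (u : C) (y : R -> C) (t : R) (a : C) :
  path_derive y t a -> is_derive (fun s => Re (u * y s)) t (Re (u * a)).
Proof.
intros H; destruct (path_derive_mult (fun _ => u) y t 0 a (path_derive_const u t) H) as [H1 _].
now replace (u * a)%C with (0 * y t + u * a)%C by ring.
Qed.

Lemma Re_conj_self (u : C) : Re (Cconj u * u) = Cmod u * Cmod u.
Proof. rewrite Cmod_sqr; unfold Re, Im; simpl; ring. Qed.

(* Apply the real mean value theorem to [Re (conj u * y)], where [u] is the increment of [y]. *)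
Lemma path_mean_value (y dy : R -> C) (a b : R) :
  a < b -> (forall t, a <= t <= b -> path_derive y t (dy t)) ->
  exists t, a <= t <= b /\ Cmod (y b - y a) <= Cmod (dy t) * (b - a).
Proof.
intros Hab H.
set (u := (y b - y a)%C).
assert (Hmin : Rmin a b = a) by (apply Rmin_left; lra).
assert (Hmax : Rmax a b = b) by (apply Rmax_right; lra).
destruct (MVT_gen (fun s => Re (Cconj u * y s)) a b (fun s => Re (Cconj u * dy s)))
  as [t [Ht Heq]]; rewrite ?Hmin, ?Hmax in *.
{ intros x Hx; apply path_derive_Re, H; lra. }
{ intros x Hx; apply continuity_pt_filterlim.
  apply (ex_derive_continuous (K := R_AbsRing) (V := R_NormedModule)).
  eexists; apply path_derive_Re, H; lra. }
exists t; split; trivial.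
assert (Hu : Cmod u * Cmod u = Re (Cconj u * dy t) * (b - a)).
{ rewrite <- Re_conj_self, <- Heq; unfold u, Re, Im; simpl; ring. }
assert (Hle : Re (Cconj u * dy t) <= Cmod u * Cmod (dy t)).
{ eapply Rle_trans; [apply Rle_abs|]; eapply Rle_trans; [apply re_le_Cmod|].
  now rewrite Cmod_mult, Cmod_conj; right. }
destruct (Rle_lt_or_eq_dec _ _ (Cmod_ge_0 u)) as [Hp|Hz].
- apply Rmult_le_reg_l with (Cmod u); trivial; rewrite Hu.
  rewrite <- Rmult_assoc; apply Rmult_le_compat_r; lra.
- rewrite <- Hz; apply Rmult_le_pos; [apply Cmod_ge_0 | lra].
Qed.

Lemma path_continuous_comp (f : C -> C) (y : R -> C) (t : R) :
  path_continuous y t -> Ccontinuous f (y t) -> path_continuous (fun s => f (y s)) t.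
Proof. apply continuous_comp. Qed.

Lemma path_continuous_scal (c : C) (y : R -> C) (t : R) :
  path_continuous y t -> path_continuous (fun s => c * y s)%C t.
Proof.
intros H; apply path_continuous_comp with (f := fun w => (c * w)%C); trivial.
eapply is_Cderive_continuous, is_Cderive_mult; [apply is_Cderive_const | apply is_Cderive_id].
Qed.

Lemma ex_CRInt_continuous (y : R -> C) (a b : R) :
  a <= b -> (forall t, a <= t <= b -> path_continuous y t) -> ex_CRInt y a b.
Proof.
intros Hab H; apply (ex_RInt_continuous (V := C_R_CompleteNormedModule)).
rewrite Rmin_left, Rmax_right by trivial; exact H.
Qed.

Lemma is_CRInt_bound (y : R -> C) (a b B : R) (l : C) :
  a <= b -> (forall t, a <= t <= b -> Cmod (y t) <= B) ->
  is_CRInt y a b l -> Cmod l <= (b - a) * B.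
Proof.
intros Hab H Hl; rewrite Cmod_norm.
apply (norm_RInt_le_const (V := C_R_NormedModule) y a b l B Hab); trivial.
intros t Ht; generalize (H t Ht); now rewrite Cmod_norm.
Qed.

Lemma is_CRInt_derive (y dy : R -> C) (a b : R) :
  a <= b -> (forall t, a <= t <= b -> path_derive y t (dy t)) ->
  (forall t, a <= t <= b -> path_continuous dy t) ->
  is_CRInt dy a b (y b - y a)%C.
Proof.
intros Hab H1 H2.
apply (is_RInt_fct_extend_pair (U := R_NormedModule) (V := R_NormedModule)).
- apply (is_RInt_derive (V := R_CompleteNormedModule) (fun s => Re (y s)) (fun s => Re (dy s)));
    rewrite Rmin_left, Rmax_right by trivial; intros t Ht; [apply H1; trivial|].
  apply (continuous_comp dy (fst : C_UniformSpace -> R_UniformSpace)); [now apply H2|].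
  apply continuous_fst.
- apply (is_RInt_derive (V := R_CompleteNormedModule) (fun s => Im (y s)) (fun s => Im (dy s)));
    rewrite Rmin_left, Rmax_right by trivial; intros t Ht; [apply H1; trivial|].
  apply (continuous_comp dy (snd : C_UniformSpace -> R_UniformSpace)); [now apply H2|].
  apply continuous_snd.
Qed.

(** * Goursat's theorem for triangles *)

(** Integrands are compared in the carrier of a module structure; the [change] restores the type [C]
    to which [ring] is attached. *)
Ltac Cring := match goal with |- ?x = ?y => change (@eq C x y) end; ring.

Definition segment_point (a b : C) (t : R) : C := (a + RtoC t * (b - a))%C.

Definition segment_int (g : C -> C) (a b : C) : C :=
  CRInt (fun t => (b - a) * g (segment_point a b t))%C 0 1.

Definition on_segment (P : C -> Prop) (a b : C) : Prop :=
  forall t, 0 <= t <= 1 -> P (segment_point a b t).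

Lemma path_derive_segment (a b : C) (t : R) : path_derive (segment_point a b) t (b - a).
Proof.
eapply path_derive_eq.
- apply path_derive_plus; [apply path_derive_const|].
  apply path_derive_mult; [|apply path_derive_const].
  apply (path_derive_RtoC (fun s => s)), (is_derive_id (K := R_AbsRing)).
- change (one : R_AbsRing) with 1; simpl; ring.
Qed.

Lemma is_segment_int (g : C -> C) (a b : C) :
  on_segment (Ccontinuous g) a b ->
  is_CRInt (fun t => (b - a) * g (segment_point a b t))%C 0 1 (segment_int g a b).
Proof.
intros H; apply (RInt_correct (V := C_R_CompleteNormedModule)).
apply ex_CRInt_continuous; [lra|]; intros t Ht.
apply path_continuous_scal, path_continuous_comp; [|now apply H].
eapply path_derive_continuous, path_derive_segment.
Qed.

Lemma segment_int_unique (g : C -> C) (a b l : C) :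
  is_CRInt (fun t => (b - a) * g (segment_point a b t))%C 0 1 l -> segment_int g a b = l.
Proof. apply (is_RInt_unique (V := C_R_CompleteNormedModule)). Qed.

Lemma scal_R_C (r : R) (z : C) : scal (V := C_R_NormedModule) r z = (RtoC r * z)%C.
Proof. apply C_eq; unfold Re, Im; simpl; unfold scal; simpl; unfold mult; simpl; ring. Qed.

(** The endpoints are tied to [u] and [v] by equations, so that [ring] matches them instead of
    unification. *)
Lemma is_CRInt_affine (y : R -> C) (u v p q : R) (l : C) :
  p = v -> q = u + v -> is_CRInt y p q l ->
  is_CRInt (fun t => RtoC u * y (u * t + v)%R)%C 0 1 l.
Proof.
intros -> -> H.
apply (is_RInt_ext (V := C_R_NormedModule)) with (fun t => scal u (y (u * t + v))).
{ intros t _; apply scal_R_C. }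
apply (is_RInt_comp_lin (V := C_R_NormedModule)).
now rewrite Rmult_0_r, Rplus_0_l, Rmult_1_r.
Qed.

Lemma segment_int_swap (g : C -> C) (a b : C) :
  on_segment (Ccontinuous g) a b -> segment_int g b a = (- segment_int g a b)%C.
Proof.
intros H; apply segment_int_unique.
assert (H1 := is_segment_int g a b H).
apply (is_RInt_swap (V := C_R_NormedModule)) in H1.
apply (is_CRInt_affine _ (- (1)) 1) in H1; [|ring|ring].
revert H1; apply (is_RInt_ext (V := C_R_NormedModule)); intros t _.
replace (segment_point b a t) with (segment_point a b (- (1) * t + 1)).
- rewrite RtoC_opp; Cring.
- unfold segment_point; rewrite RtoC_plus, RtoC_mult, RtoC_opp; ring.
Qed.

(** The ratio [s] is arbitrary because two cuts are made: at [1 / 2] in the bisection, and close to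
    the origin in [quadrilateral_int]. *)
Lemma segment_int_split (g : C -> C) (a b : C) (s : R) :
  0 <= s <= 1 -> on_segment (Ccontinuous g) a b ->
  segment_int g a b
  = (segment_int g a (segment_point a b s) + segment_int g (segment_point a b s) b)%C.
Proof.
intros Hs H.
set (m := segment_point a b s).
assert (Hex : forall u v, 0 <= u <= v -> v <= 1 ->
  ex_CRInt (fun t => (b - a) * g (segment_point a b t))%C u v).
{ intros u v Hu Hv; apply ex_CRInt_continuous; [lra|]; intros t Ht.
  apply path_continuous_scal, path_continuous_comp; [|apply H; lra].
  eapply path_derive_continuous, path_derive_segment. }
assert (Hc := RInt_Chasles (V := C_R_CompleteNormedModule) _ 0 s 1
   (Hex 0 s ltac:(lra) ltac:(lra)) (Hex s 1 ltac:(lra) ltac:(lra))).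
unfold segment_int at 1; rewrite <- Hc.
assert (H1 := RInt_correct (V := C_R_CompleteNormedModule) _ _ _ (Hex 0 s ltac:(lra) ltac:(lra))).
assert (H2 := RInt_correct (V := C_R_CompleteNormedModule) _ _ _ (Hex s 1 ltac:(lra) ltac:(lra))).
revert H1 H2; generalize (CRInt (fun t => (b - a) * g (segment_point a b t))%C 0 s).
generalize (CRInt (fun t => (b - a) * g (segment_point a b t))%C s 1); intros l2 l1 H1 H2.
change (plus l1 l2) with (l1 + l2)%C; f_equal; symmetry; apply segment_int_unique.
- apply (is_CRInt_affine _ s 0) in H1; [|ring|ring].
  revert H1; apply (is_RInt_ext (V := C_R_NormedModule)); intros t _.
  replace (segment_point a m t) with (segment_point a b (s * t + 0)).
  + unfold m, segment_point; Cring.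
  + unfold m, segment_point; rewrite RtoC_plus, RtoC_mult; ring.
- apply (is_CRInt_affine _ (1 - s) s) in H2; [|ring|ring].
  revert H2; apply (is_RInt_ext (V := C_R_NormedModule)); intros t _.
  replace (segment_point m b t) with (segment_point a b ((1 - s) * t + s)).
  + unfold m, segment_point; rewrite RtoC_minus; Cring.
  + unfold m, segment_point; rewrite RtoC_plus, RtoC_mult, RtoC_minus; ring.
Qed.

Lemma segment_int_minus (g h : C -> C) (a b : C) :
  on_segment (Ccontinuous g) a b -> on_segment (Ccontinuous h) a b ->
  segment_int (fun z => g z - h z)%C a b = (segment_int g a b - segment_int h a b)%C.
Proof.
intros Hg Hh; apply segment_int_unique.
apply (is_RInt_ext (V := C_R_NormedModule)) with
  (fun t => minus (G := C_R_NormedModule) ((b - a) * g (segment_point a b t))%C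
                  ((b - a) * h (segment_point a b t))%C).
- intros t _; change (minus (G := C_R_NormedModule)) with Cminus; Cring.
- apply (is_RInt_minus (V := C_R_NormedModule)); now apply is_segment_int.
Qed.

Lemma segment_int_derive (G g : C -> C) (a b : C) :
  on_segment (fun z => is_Cderive G z (g z)) a b -> on_segment (Ccontinuous g) a b ->
  segment_int g a b = (G b - G a)%C.
Proof.
intros HG Hg; apply segment_int_unique.
replace (G b) with (G (segment_point a b 1)) by (f_equal; unfold segment_point; ring).
replace (G a) with (G (segment_point a b 0)) by (f_equal; unfold segment_point; ring).
apply is_CRInt_derive with (y := fun t => G (segment_point a b t)); [lra| |]; intros t Ht.
- rewrite Cmult_comm; apply path_derive_comp; [now apply HG | apply path_derive_segment].
- apply path_continuous_scal, path_continuous_comp; [|now apply Hg].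
  eapply path_derive_continuous, path_derive_segment.
Qed.

Lemma segment_int_bound (g : C -> C) (a b : C) (B : R) :
  on_segment (Ccontinuous g) a b -> on_segment (fun z => Cmod (g z) <= B) a b ->
  Cmod (segment_int g a b) <= Cmod (b - a) * B.
Proof.
intros Hg HB.
replace (Cmod (b - a) * B) with ((1 - 0) * (Cmod (b - a) * B)) by ring.
refine (is_CRInt_bound _ 0 1 _ _ Rle_0_1 _ (is_segment_int g a b Hg)).
intros t Ht; rewrite Cmod_mult; apply Rmult_le_compat_l; [apply Cmod_ge_0 | now apply HB].
Qed.

(** * Bisection of triangles *)

Definition triangle_int (g : C -> C) (a b c : C) : C :=
  (segment_int g a b + segment_int g b c + segment_int g c a)%C.

Definition convex_set (S : C -> Prop) : Prop := forall a b, S a -> S b -> on_segment S a b.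

Definition closed_set (S : C -> Prop) : Prop :=
  forall z, (forall e, 0 < e -> exists w, S w /\ Cmod (w - z) < e) -> S z.

Definition midpoint (a b : C) : C := segment_point a b (/ 2).

Lemma triangle_int_split (S : C -> Prop) (g : C -> C) (a b c : C) :
  convex_set S -> (forall z, S z -> Ccontinuous g z) -> S a -> S b -> S c ->
  let m1 := midpoint a b in let m2 := midpoint b c in let m3 := midpoint c a in
  triangle_int g a b c
  = (triangle_int g a m1 m3 + triangle_int g m1 b m2 + triangle_int g m3 m2 c
     + triangle_int g m1 m2 m3)%C.
Proof.
intros HS Hg Ha Hb Hc m1 m2 m3.
assert (Hcont : forall u v, S u -> S v -> on_segment (Ccontinuous g) u v).
{ intros u v Hu Hv t Ht; apply Hg; now apply HS. }
assert (Hhalf : 0 <= / 2 <= 1) by lra.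
assert (H1 : S m1) by now apply HS.
assert (H2 : S m2) by now apply HS.
assert (H3 : S m3) by now apply HS.
unfold triangle_int.
rewrite (segment_int_split g a b (/ 2)), (segment_int_split g b c (/ 2)),
  (segment_int_split g c a (/ 2)) by auto.
fold (midpoint a b) (midpoint b c) (midpoint c a); fold m1 m2 m3.
(* The sides of the middle triangle are traversed once in each direction and cancel. *)
rewrite (segment_int_swap g m1 m2), (segment_int_swap g m2 m3), (segment_int_swap g m3 m1) by auto.
ring.
Qed.

Definition triangle_integral (g : C -> C) (T : C * C * C) : C :=
  let '(a, b, c) := T in triangle_int g a b c.

(** Selects a part carrying at least a quarter of the integral. The middle triangle needs no test:
    if the other three fall short, it has to carry its share. *)
Definition quarter_triangle (g : C -> C) (T : C * C * C) : C * C * C :=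
  let '(a, b, c) := T in
  let m1 := midpoint a b in let m2 := midpoint b c in let m3 := midpoint c a in
  let large (T' : C * C * C) := 
    Rle_dec (Cmod (triangle_int g a b c) / 4) (Cmod (triangle_integral g T')) in
  if large (a, m1, m3) then (a, m1, m3)
  else if large (m1, b, m2) then (m1, b, m2)
  else if large (m3, m2, c) then (m3, m2, c)
  else (m1, m2, m3).

Definition triangle_in (S : C -> Prop) (d : R) (T : C * C * C) : Prop :=
  let '(a, b, c) := T in
  (S a /\ S b /\ S c) /\ Cmod (b - a) <= d /\ Cmod (c - b) <= d /\ Cmod (a - c) <= d.

Definition first_vertex (T : C * C * C) : C := fst (fst T).

Lemma half_side (u v w z : C) (d : R) :
  (v - u = RtoC (/ 2) * (z - w))%C -> Cmod (z - w) <= d -> Cmod (v - u) <= d / 2.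
Proof.
intros -> H; rewrite Cmod_mult, Cmod_R, Rabs_pos_eq; lra.
Qed.

Lemma quarter_triangle_spec (S : C -> Prop) (g : C -> C) (T : C * C * C) (d : R) :
  convex_set S -> (forall z, S z -> Ccontinuous g z) -> triangle_in S d T ->
  let T' := quarter_triangle g T in
  triangle_in S (d / 2) T' /\
  Cmod (triangle_integral g T) / 4 <= Cmod (triangle_integral g T') /\
  Cmod (first_vertex T' - first_vertex T) <= d / 2.
Proof.
intros HS Hg; destruct T as [[a b] c]; intros [[Ha [Hb Hc]] [Hab [Hbc Hca]]].
assert (Hhalf : 0 <= / 2 <= 1) by lra.
assert (H1 : S (midpoint a b)) by now apply HS.
assert (H2 : S (midpoint b c)) by now apply HS.
assert (H3 : S (midpoint c a)) by now apply HS.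
assert (Hsplit := triangle_int_split S g a b c HS Hg Ha Hb Hc); cbv zeta in Hsplit.
assert (Hsum : Cmod (triangle_int g a b c) <=
  Cmod (triangle_int g a (midpoint a b) (midpoint c a)) +
  Cmod (triangle_int g (midpoint a b) b (midpoint b c)) +
  Cmod (triangle_int g (midpoint c a) (midpoint b c) c) +
  Cmod (triangle_int g (midpoint a b) (midpoint b c) (midpoint c a))).
{ rewrite Hsplit at 1.
  eapply Rle_trans; [apply Cmod_triangle|]; apply Rplus_le_compat_r.
  eapply Rle_trans; [apply Cmod_triangle|]; apply Rplus_le_compat_r.
  apply Cmod_triangle. }
assert (Hd : 0 <= d) by (eapply Rle_trans; [apply Cmod_ge_0 | exact Hab]).
(* Every side of a part, and every nonzero displacement of the first vertex, is half of a side of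
   the original, possibly reversed. *)
assert (E : forall u v w z : C, (v - u = RtoC (/ 2) * (z - w))%C ->
   Cmod (z - w) <= d -> Cmod (v - u) <= d / 2) by (intros; eapply half_side; eauto).
assert (Hba : Cmod (a - b) <= d) by now rewrite Cmod_minus_sym.
assert (Hcb : Cmod (b - c) <= d) by now rewrite Cmod_minus_sym.
assert (Hac : Cmod (c - a) <= d) by now rewrite Cmod_minus_sym.
unfold quarter_triangle; cbv zeta.
repeat match goal with |- context [Rle_dec ?x ?y] => destruct (Rle_dec x y) end;
  unfold first_vertex; simpl in *; repeat split; trivial; try lra;
  try (replace (a - a)%C with (RtoC 0) by ring; rewrite Cmod_0; lra);
  solve [match goal with H : Cmod (?z - ?w) <= d |- _ =>
    apply (E _ _ w z); [|exact H];
    apply C_eq; unfold midpoint, segment_point, Re, Im; simpl; lra end].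
Qed.

(** The intervals [[x n - e n, x n + e n]] are nested, and the supremum of their left ends lies in
    all of them. *)
Lemma shrinking_limit (x e : nat -> R) :
  (forall n, 0 <= e n) -> (forall n, Rabs (x (S n) - x n) <= e n - e (S n)) ->
  exists l, forall n, Rabs (x n - l) <= e n.
Proof.
intros He Hx.
assert (Hmono : forall n k, x n - e n <= x (n + k)%nat - e (n + k)%nat
                         /\ x (n + k)%nat + e (n + k)%nat <= x n + e n).
{ intros n k; induction k.
  - rewrite Nat.add_0_r; lra.
  - rewrite Nat.add_succ_r.
    specialize (Hx (n + k)%nat); apply Rabs_le_between in Hx; lra. }
assert (Hnm : forall n m, x n - e n <= x m + e m).
{ intros n m; destruct (Nat.le_ge_cases n m) as [H|H].
  - destruct (Hmono n (m - n)%nat) as [H1 H2].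
    replace (n + (m - n))%nat with m in * by lia; specialize (He m); lra.
  - destruct (Hmono m (n - m)%nat) as [H1 H2].
    replace (m + (n - m))%nat with n in * by lia; specialize (He n); lra. }
destruct (completeness (fun r => exists n, r = x n - e n)) as [l [Hub Hlub]].
- exists (x 0%nat + e 0%nat); intros r [n ->]; apply Hnm.
- exists (x 0%nat - e 0%nat); now exists 0%nat.
- exists l; intros n; apply Rabs_le_between.
  assert (H1 : x n - e n <= l) by (apply Hub; now exists n).
  assert (H2 : l <= x n + e n) by (apply Hlub; intros r [m ->]; apply Hnm).
  lra.
Qed.

Fixpoint nested_triangle (g : C -> C) (T : C * C * C) (n : nat) : C * C * C :=
  match n with
  | O => T
  | S k => quarter_triangle g (nested_triangle g T k)
  end.

Lemma nested_triangle_spec (S : C -> Prop) (g : C -> C) (T : C * C * C) (d : R) (n : nat) :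
  convex_set S -> (forall z, S z -> Ccontinuous g z) -> triangle_in S d T ->
  triangle_in S (d * (/ 2) ^ n) (nested_triangle g T n) /\
  Cmod (triangle_integral g T) * (/ 4) ^ n <= Cmod (triangle_integral g (nested_triangle g T n)).
Proof.
intros HS Hg HT; induction n as [|n [IH1 IH2]].
- simpl; rewrite !Rmult_1_r; split; [exact HT | apply Rle_refl].
- destruct (quarter_triangle_spec S g _ _ HS Hg IH1) as [H1 [H2 _]].
  split.
  + replace (d * (/ 2) ^ Datatypes.S n) with (d * (/ 2) ^ n / 2) by (simpl; lra); exact H1.
  + eapply Rle_trans; [|exact H2]; simpl; lra.
Qed.

(* The affine part of [g] at the limit point of the bisection has a primitive, so only the
   [o(|w - z|)] remainder contributes. *)
Lemma small_triangle_bound (S : C -> Prop) (g : C -> C) (z l : C) (e r d : R) (a b c : C) :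
  convex_set S -> (forall w, S w -> Ccontinuous g w) -> triangle_in S d (a, b, c) ->
  0 <= e -> 6 * d < r -> Cmod (a - z) <= 4 * d ->
  (forall w, Cmod (w - z) < r -> Cmod (g w - g z - l * (w - z)) <= e * Cmod (w - z)) ->
  Cmod (triangle_int g a b c) <= 18 * e * (d * d).
Proof.
intros HS Hg [[Ha [Hb Hc]] [Hab [Hbc Hca]]] He Hr Haz Hl.
assert (Hd : 0 <= d) by (eapply Rle_trans; [apply Cmod_ge_0 | exact Hab]).
set (h := fun w => (g z + l * (w - z))%C).
set (H := fun w => (g z * w + l * ((w - z) * (w - z) / 2))%C).
assert (HH : forall w, is_Cderive H w (h w)).
{ intros w; unfold H, h.
  assert (Hwz : is_Cderive (fun w => w - z)%C w (1 - 0)%C)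
    by (apply is_Cderive_minus; [apply is_Cderive_id | apply is_Cderive_const]).
  eapply is_Cderive_eq.
  - apply is_Cderive_plus; (apply is_Cderive_mult; [apply is_Cderive_const|]).
    + apply is_Cderive_id.
    + apply is_Cderive_mult; [|apply is_Cderive_const].
      exact (is_Cderive_mult _ _ _ _ _ Hwz Hwz).
  - simpl; field; intros E; apply (f_equal Re) in E; simpl in E; lra. }
assert (Hh : forall w, Ccontinuous h w).
{ intros w; eapply is_Cderive_continuous; unfold h.
  apply is_Cderive_plus; [apply is_Cderive_const|].
  apply is_Cderive_mult; [apply is_Cderive_const|].
  apply is_Cderive_minus; [apply is_Cderive_id | apply is_Cderive_const]. }
assert (Hgh : forall w, S w -> Ccontinuous (fun w => g w - h w)%C w).
{ intros w Hw; apply (continuous_minus (K := R_AbsRing) (V := C_R_NormedModule)); [now apply Hg | apply Hh]. }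
(* [a] is within [4 d] of [z], hence the other vertices within [5 d] and the points of the sides
   within [6 d]. Each of the three sides contributes at most [d * (e * (6 d))], which gives the
   [18]. *)
assert (Hside : forall u v, S u -> S v -> Cmod (v - u) <= d -> Cmod (u - z) <= 5 * d ->
   Cmod (segment_int g u v - (H v - H u)) <= 6 * e * (d * d)).
{ intros u v Hu Hv Huv Huz.
  rewrite <- (segment_int_derive H h u v); [|intros t _; apply HH | intros t _; apply Hh].
  rewrite <- segment_int_minus;
    [|intros t Ht; apply Hg; now apply HS | intros t _; apply Hh].
  apply Rle_trans with (Cmod (v - u) * (e * (6 * d))).
  - apply segment_int_bound; [intros t Ht; apply Hgh; now apply HS|].
    intros t Ht.
    assert (Hp : Cmod (segment_point u v t - z) <= 6 * d).
    { replace (segment_point u v t - z)%C with ((u - z) + RtoC t * (v - u))%C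
        by (unfold segment_point; ring).
      eapply Rle_trans; [apply Cmod_triangle|]; rewrite Cmod_mult, Cmod_pos_real by lra.
      assert (0 <= Cmod (v - u)) by apply Cmod_ge_0; nra. }
    replace (g (segment_point u v t) - h (segment_point u v t))%C
      with (g (segment_point u v t) - g z - l * (segment_point u v t - z))%C
      by (unfold h; ring).
    eapply Rle_trans; [apply Hl; lra|]; now apply Rmult_le_compat_l.
  - apply Rle_trans with (d * (e * (6 * d))); [|right; ring].
    apply Rmult_le_compat_r; trivial; apply Rmult_le_pos; lra. }
unfold triangle_int.
replace (segment_int g a b + segment_int g b c + segment_int g c a)%C with
  ((segment_int g a b - (H b - H a)) + (segment_int g b c - (H c - H b))
   + (segment_int g c a - (H a - H c)))%C by ring.
eapply Rle_trans; [apply Cmod_triangle|].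
eapply Rle_trans; [apply Rplus_le_compat_r, Cmod_triangle|].
assert (H1 := Hside a b Ha Hb Hab ltac:(lra)).
assert (H2 : Cmod (b - z) <= 5 * d) by (generalize (Cmod_minus_triangle b a z); lra).
assert (H3 : Cmod (c - z) <= 5 * d).
{ generalize (Cmod_minus_triangle c a z); rewrite (Cmod_minus_sym c a); lra. }
assert (H4 := Hside b c Hb Hc Hbc H2).
assert (H5 := Hside c a Hc Ha Hca H3).
lra.
Qed.

(** The closed convex set stands for the filled triangle: convexity keeps midpoints and sides
    inside, closedness the limit of the bisection. *)
Theorem goursat_triangle (S : C -> Prop) (g : C -> C) (a b c : C) :
  convex_set S -> closed_set S -> (forall z, S z -> exists l, is_Cderive g z l) ->
  S a -> S b -> S c -> triangle_int g a b c = 0.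
Proof.
intros HS Hclosed Hg Ha Hb Hc.
assert (Hcont : forall z, S z -> Ccontinuous g z).
{ intros z Hz; destruct (Hg z Hz) as [l Hl]; eapply is_Cderive_continuous; exact Hl. }
set (d := Cmod (b - a) + Cmod (c - b) + Cmod (a - c) + 1).
assert (H1 := Cmod_ge_0 (b - a)); assert (H2 := Cmod_ge_0 (c - b)); assert (H3 := Cmod_ge_0 (a - c)).
assert (HT : triangle_in S d (a, b, c)) by (unfold d; repeat split; trivial; lra).
assert (Hd : 0 < d) by (unfold d; lra).
set (T := nested_triangle g (a, b, c)).
assert (Hpow : forall n, 0 < (/ 2) ^ n) by (intros n; apply pow_lt; lra).
assert (Hspec : forall n, triangle_in S (d * (/ 2) ^ n) (T n) /\
  Cmod (triangle_int g a b c) * (/ 4) ^ n <= Cmod (triangle_integral g (T n)))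
  by (intros n; now apply nested_triangle_spec).
assert (Hstep : forall n, Cmod (first_vertex (T (Datatypes.S n)) - first_vertex (T n))
   <= 2 * d * (/ 2) ^ n - 2 * d * (/ 2) ^ (Datatypes.S n)).
{ intros n; destruct (quarter_triangle_spec S g _ _ HS Hcont (proj1 (Hspec n))) as [_ [_ H]].
  eapply Rle_trans; [exact H|]; simpl; specialize (Hpow n); nra. }
assert (Hpos : forall n, 0 <= 2 * d * (/ 2) ^ n).
{ intros n; specialize (Hpow n); nra. }
destruct (shrinking_limit (fun n => Re (first_vertex (T n))) _ Hpos) as [x Hx].
{ intros n; eapply Rle_trans; [|apply Hstep]; rewrite <- re_le_Cmod; right; reflexivity. }
destruct (shrinking_limit (fun n => Im (first_vertex (T n))) _ Hpos) as [y Hy].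
{ intros n; eapply Rle_trans; [|apply Hstep]; rewrite <- im_le_Cmod; right; reflexivity. }
set (z := (x, y) : C).
(* Each coordinate is within [2 d / 2^n] of its limit, and the modulus is at most the sum of the
   two. *)
assert (Hz : forall n, Cmod (first_vertex (T n) - z) <= 4 * (d * (/ 2) ^ n)).
{ intros n; eapply Rle_trans; [apply Cmod_le_sum|].
  specialize (Hx n); specialize (Hy n).
  change (Rabs (Re (first_vertex (T n)) - x) + Rabs (Im (first_vertex (T n)) - y)
    <= 4 * (d * (/ 2) ^ n)); lra. }
assert (Hsmall : forall r, 0 < r -> exists n, 6 * (d * (/ 2) ^ n) < r).
{ intros r Hr.
  destruct (pow_lt_1_zero (/ 2)) with (y := r / (6 * d)) as [N HN].
  - rewrite Rabs_pos_eq; lra.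
  - apply Rdiv_lt_0_compat; lra.
  - exists N; specialize (HN N (le_n _)); rewrite Rabs_pos_eq in HN by (apply Rlt_le, Hpow).
    apply (Rmult_lt_compat_l (6 * d)) in HN; [|lra].
    replace (6 * d * (r / (6 * d))) with r in HN by (field; lra); lra. }
assert (HSz : S z).
{ apply Hclosed; intros r Hr; destruct (Hsmall r Hr) as [n Hn].
  exists (first_vertex (T n)); split.
  - destruct (Hspec n) as [H _]; revert H; destruct (T n) as [[u v] w]; unfold triangle_in; tauto.
  - specialize (Hz n); specialize (Hpow n); nra. }
destruct (Hg z HSz) as [l Hl]; rewrite is_Cderive_eps in Hl.
apply Cmod_eq_0, Rle_antisym; [|apply Cmod_ge_0].
apply le_epsilon; intros e He; rewrite Rplus_0_l.
(* With this tolerance the bound [18 e' (d / 2^n)^2] of [small_triangle_bound] is exactly [e / 4^n],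
   the rate at which the integrals may decrease. *)
assert (He' : 0 < e / (18 * (d * d))) by (apply Rdiv_lt_0_compat; nra).
destruct (Hl _ He') as [r [Hr Hlr]].
destruct (Hsmall r Hr) as [n Hn].
destruct (Hspec n) as [Hin Hbig]; specialize (Hz n); revert Hin Hbig Hz.
destruct (T n) as [[u v] w]; intros Hin Hbig Hz.
assert (Hb' := small_triangle_bound S g z l _ r _ u v w HS Hcont Hin (Rlt_le _ _ He') Hn Hz Hlr).
assert (Hp4 : 0 < (/ 4) ^ n) by (apply pow_lt; lra).
apply Rmult_le_reg_r with ((/ 4) ^ n); trivial.
eapply Rle_trans; [exact Hbig|]; eapply Rle_trans; [exact Hb'|]; right.
replace ((/ 4) ^ n) with ((/ 2) ^ n * (/ 2) ^ n).
- field; lra.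
- rewrite <- Rpow_mult_distr; f_equal; lra.
Qed.

(** * Primitives on the disk punctured at the origin *)

Lemma segment_point_Cmod_le (a b : C) (r t : R) :
  0 <= t <= 1 -> Cmod a <= r -> Cmod b <= r -> Cmod (segment_point a b t) <= r.
Proof.
intros Ht Ha Hb.
replace (segment_point a b t) with (RtoC (1 - t) * a + RtoC t * b)%C
  by (unfold segment_point; rewrite RtoC_minus; ring).
eapply Rle_trans; [apply Cmod_triangle|].
rewrite !Cmod_mult, !Cmod_pos_real by lra; nra.
Qed.

Lemma segment_point_0 (z : C) (t : R) : segment_point 0 z t = (RtoC t * z)%C.
Proof. unfold segment_point; ring. Qed.

(** A disc cut by a half-plane orthogonal to [z]. For [0 < m] it is closed, convex and misses the
    origin. *)
Definition circular_segment (z : C) (r m : R) (x : C) : Prop :=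
  Cmod x <= r /\ m <= Re (Cconj z * x).

Lemma circular_segment_convex (z : C) (r m : R) : convex_set (circular_segment z r m).
Proof.
intros a b [Ha1 Ha2] [Hb1 Hb2] t Ht; split; [now apply segment_point_Cmod_le|].
replace (Re (Cconj z * segment_point a b t))
  with ((1 - t) * Re (Cconj z * a) + t * Re (Cconj z * b)); [nra|].
unfold segment_point, Re, Im; simpl; ring.
Qed.

Lemma circular_segment_closed (z : C) (r m : R) : closed_set (circular_segment z r m).
Proof.
intros x H; split.
- apply le_epsilon; intros e He; destruct (H e He) as [w [[Hw _] Hwx]].
  generalize (Cmod_triangle_rev x w); rewrite Cmod_minus_sym; lra.
- apply le_epsilon; intros e He.
  assert (Hz := Cmod_ge_0 z).
  destruct (H (e / (Cmod z + 1))) as [w [[_ Hw] Hwx]].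
  { apply Rdiv_lt_0_compat; lra. }
  assert (H1 : Re (Cconj z * w) - Re (Cconj z * x) <= Cmod z * Cmod (w - x)).
  { replace (Re (Cconj z * w) - Re (Cconj z * x)) with (Re (Cconj z * (w - x)))
      by (unfold Re, Im; simpl; ring).
    rewrite <- (Cmod_conj z), <- Cmod_mult.
    eapply Rle_trans; [apply Rle_abs | apply re_le_Cmod]. }
  apply (Rmult_lt_compat_r (Cmod z + 1)) in Hwx; [|lra].
  replace (e / (Cmod z + 1) * (Cmod z + 1)) with e in Hwx by (field; lra).
  assert (H2 := Cmod_ge_0 (w - x)); nra.
Qed.

Lemma Re_conj_ge (z w : C) : Cmod z * Cmod z - Cmod z * Cmod (w - z) <= Re (Cconj z * w).
Proof.
assert (H : - Re (Cconj z * (w - z)) <= Cmod z * Cmod (w - z)).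
{ rewrite <- (Cmod_conj z), <- Cmod_mult.
  eapply Rle_trans; [|apply re_le_Cmod]; rewrite <- Rabs_Ropp; apply Rle_abs. }
rewrite Cmod_sqr in *.
replace (Re (Cconj z * (w - z))) with (Re (Cconj z * w) - (Re z * Re z + Im z * Im z)) in H
  by (unfold Re, Im; simpl; ring); lra.
Qed.

Section Primitive.

Variable g : C -> C.
Hypothesis g_continuous : forall z, unit_disk z -> Ccontinuous g z.
Hypothesis g_derivable :
  forall z, unit_disk z -> z <> RtoC 0 -> exists l, is_Cderive g z l.

Lemma disk_segment_continuous (a b : C) :
  unit_disk a -> unit_disk b -> on_segment (Ccontinuous g) a b.
Proof.
intros Ha Hb t Ht; apply g_continuous.
eapply Rle_lt_trans; [apply segment_point_Cmod_le with (r := Rmax (Cmod a) (Cmod b))|].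
- trivial.
- apply Rmax_l.
- apply Rmax_r.
- now apply Rmax_lub_lt.
Qed.

(* Cut off the corner at the origin of the triangle [0, z, w]; the remaining quadrilateral is
   covered by two triangles on which [g] is differentiable. *)
Lemma quadrilateral_int (z w : C) (s : R) :
  unit_disk z -> z <> RtoC 0 -> unit_disk w -> Cmod (w - z) <= Cmod z / 2 -> 0 < s < 1 ->
  let z' := (RtoC s * z)%C in let w' := (RtoC s * w)%C in
  (segment_int g 0 w - segment_int g 0 z - segment_int g z w
   = segment_int g 0 w' - segment_int g 0 z' - segment_int g z' w')%C.
Proof.
intros Hz Hz0 Hw Hzw Hs z' w'.
assert (Hm := proj1 (Cmod_gt_0 z) Hz0); set (m := Cmod z) in *.
assert (H0 : unit_disk 0) by (unfold unit_disk; rewrite Cmod_0; lra).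
(* From [|w - z| <= m / 2] follows [Re (conj z * w) >= m^2 / 2]. Scaling by [s] scales this bound,
   so the same half-plane contains all four vertices. *)
set (S := circular_segment z (Rmax m (Cmod w)) (s * (m * m / 2))).
assert (Hrw : m * m / 2 <= Re (Cconj z * w)).
{ generalize (Re_conj_ge z w); fold m; nra. }
assert (Hrz : Re (Cconj z * z) = m * m) by apply Re_conj_self.
assert (Hscal : forall x, Re (Cconj z * (RtoC s * x)) = s * Re (Cconj z * x))
  by (intros; unfold Re, Im; simpl; ring).
assert (Hmm : 0 < m * m) by now apply Rmult_lt_0_compat.
assert (Hmax := Rmax_l m (Cmod w)); assert (Hmax' := Rmax_r m (Cmod w)).
assert (Hw0 := Cmod_ge_0 w).
assert (Sz : S z) by (split; [exact Hmax | rewrite Hrz; nra]).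
assert (Sw : S w) by (split; [exact Hmax' | nra]).
assert (Sz' : S z').
{ split; [|unfold z'; rewrite Hscal, Hrz; nra].
  unfold z'; rewrite Cmod_mult, Cmod_pos_real by lra; fold m; nra. }
assert (Sw' : S w').
{ split; [|unfold w'; rewrite Hscal; nra].
  unfold w'; rewrite Cmod_mult, Cmod_pos_real by lra; nra. }
assert (HS : forall x, S x -> unit_disk x).
{ intros x [Hx _]; eapply Rle_lt_trans; [exact Hx | now apply Rmax_lub_lt]. }
assert (HgS : forall x, S x -> exists l, is_Cderive g x l).
{ intros x Hx; apply g_derivable; [now apply HS|]; intros ->.
  destruct Hx as [_ Hx].
  replace (Re (Cconj z * 0)) with 0 in Hx by (unfold Re, Im; simpl; ring); nra. }
assert (T1 := goursat_triangle S g z' z w (circular_segment_convex _ _ _)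
   (circular_segment_closed _ _ _) HgS Sz' Sz Sw).
assert (T2 := goursat_triangle S g z' w w' (circular_segment_convex _ _ _)
   (circular_segment_closed _ _ _) HgS Sz' Sw Sw').
unfold triangle_int in T1, T2.
assert (Hc := disk_segment_continuous).
rewrite (segment_int_split g 0 z s), (segment_int_split g 0 w s) by (auto; lra).
rewrite !segment_point_0; fold z' w'.
rewrite (segment_int_swap g z' w) in T1 by auto.
rewrite (segment_int_swap g w' w), (segment_int_swap g z' w') in T2 by auto.
(* The two vanishing triangle integrals are subtracted; the diagonal from [z'] to [w] cancels. *)
transitivity (segment_int g 0 w' - segment_int g 0 z' - segment_int g z' w'
  - (segment_int g z' z + segment_int g z w + - segment_int g z' w)
  - (segment_int g z' w + - segment_int g w' w + - segment_int g z' w'))%C;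
  [ring | rewrite T1, T2; ring].
Qed.

(** The defect equals that of the corner scaled by [s], for every small [s]. The corner has
    perimeter [O(s)] and [g] is bounded near [0], so the defect is [0]. *)
Lemma segment_int_additive (z w : C) :
  unit_disk z -> z <> RtoC 0 -> unit_disk w -> Cmod (w - z) <= Cmod z / 2 ->
  (segment_int g 0 w - segment_int g 0 z)%C = segment_int g z w.
Proof.
intros Hz Hz0 Hw Hzw.
assert (H0 : unit_disk 0) by (unfold unit_disk; rewrite Cmod_0; lra).
set (D := (segment_int g 0 w - segment_int g 0 z - segment_int g z w)%C).
cut (D = RtoC 0).
{ intros HD; transitivity (D + segment_int g z w)%C; [unfold D; ring | rewrite HD; ring]. }
destruct (proj1 (Ccontinuous_eps g 0) (g_continuous 0 H0) 1 Rlt_0_1) as [d [Hd Hg]].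
set (B := Cmod (g 0) + 1).
assert (HB : 0 < B) by (unfold B; generalize (Cmod_ge_0 (g 0)); lra).
assert (Hbound : forall x, Cmod x < d -> Cmod (g x) <= B).
{ intros x Hx; generalize (Cmod_triangle_rev (g x) (g 0)).
  assert (H := Hg x); replace (x - 0)%C with x in H by ring.
  specialize (H Hx); unfold B; lra. }
apply Cmod_eq_0, Rle_antisym; [|apply Cmod_ge_0].
apply le_epsilon; intros e He; rewrite Rplus_0_l.
(* [1 / 2] keeps the corner in the disk, [d / 2] keeps it where [|g| <= B], and [e / (4 B)]
   compensates for its perimeter, at most [s + s + 2 s]. *)
set (s := Rmin (/ 2) (Rmin (d / 2) (e / (4 * B)))).
assert (Hs0 : 0 < s).
{ repeat apply Rmin_pos; try lra; apply Rdiv_lt_0_compat; lra. }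
assert (Hs1 : s <= / 2) by apply Rmin_l.
assert (Hs2 : s <= d / 2) by (eapply Rle_trans; [apply Rmin_r | apply Rmin_l]).
assert (Hs3 : s <= e / (4 * B)) by (eapply Rle_trans; [apply Rmin_r | apply Rmin_r]).
unfold D; rewrite (quadrilateral_int z w s) by (trivial; lra).
assert (Hsx : forall x, unit_disk x -> Cmod (RtoC s * x) <= s).
{ intros x Hx; unfold unit_disk in Hx; rewrite Cmod_mult, Cmod_pos_real by lra.
  generalize (Cmod_ge_0 x); nra. }
assert (Hzw1 : Cmod (RtoC s * w - RtoC s * z) <= 2 * s).
{ generalize (Cmod_triangle (RtoC s * w) (- (RtoC s * z))); rewrite Cmod_opp.
  assert (H1 := Hsx z Hz); assert (H2 := Hsx w Hw); unfold Cminus; lra. }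
assert (Hseg : forall a b, Cmod a <= s -> Cmod b <= s ->
  Cmod (segment_int g a b) <= Cmod (b - a) * B).
{ intros a b Ha Hb; apply segment_int_bound.
  - apply disk_segment_continuous; unfold unit_disk; lra.
  - intros t Ht; apply Hbound.
    eapply Rle_lt_trans; [now apply segment_point_Cmod_le with (r := s) | lra]. }
assert (Hs00 : Cmod 0 <= s) by (rewrite Cmod_0; lra).
assert (E1 := Hseg 0 (RtoC s * w)%C Hs00 (Hsx w Hw)).
assert (E2 := Hseg 0 (RtoC s * z)%C Hs00 (Hsx z Hz)).
assert (E3 := Hseg _ _ (Hsx z Hz) (Hsx w Hw)).
replace (RtoC s * w - 0)%C with (RtoC s * w)%C in E1 by ring.
replace (RtoC s * z - 0)%C with (RtoC s * z)%C in E2 by ring.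
apply Rle_trans with (s * B + s * B + 2 * s * B).
- unfold Cminus; eapply Rle_trans; [apply Cmod_triangle|]; rewrite Cmod_opp.
  apply Rplus_le_compat.
  + eapply Rle_trans; [apply Cmod_triangle|]; rewrite Cmod_opp.
    apply Rplus_le_compat.
    * eapply Rle_trans; [exact E1|]; apply Rmult_le_compat_r; [lra | now apply Hsx].
    * eapply Rle_trans; [exact E2|]; apply Rmult_le_compat_r; [lra | now apply Hsx].
  + eapply Rle_trans; [exact E3|]; apply Rmult_le_compat_r; lra.
- apply (Rmult_le_compat_r (4 * B)) in Hs3; [|lra].
  replace (e / (4 * B) * (4 * B)) with e in Hs3 by (field; lra); lra.
Qed.

Lemma segment_int_primitive (z : C) :
  unit_disk z -> z <> RtoC 0 -> is_Cderive (segment_int g 0) z (g z).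
Proof.
intros Hz Hz0; apply is_Cderive_eps; intros e He.
destruct (proj1 (Ccontinuous_eps g z) (g_continuous z Hz) e He) as [d [Hd Hg]].
assert (Hm := proj1 (Cmod_gt_0 z) Hz0); unfold unit_disk in Hz.
exists (Rmin d (Rmin (Cmod z / 2) (1 - Cmod z))); split.
{ repeat apply Rmin_pos; lra. }
intros w Hw.
assert (H1 := Rlt_le_trans _ _ _ Hw (Rmin_l _ _)).
assert (H23 := Rlt_le_trans _ _ _ Hw (Rmin_r _ _)).
assert (H2 := Rlt_le_trans _ _ _ H23 (Rmin_l _ _)).
assert (H3 := Rlt_le_trans _ _ _ H23 (Rmin_r _ _)).
assert (Hwd : unit_disk w) by (unfold unit_disk; generalize (Cmod_triangle_rev w z); lra).
rewrite segment_int_additive by (trivial; lra).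
assert (Hconst : forall x, Ccontinuous (fun _ => g z) x)
  by (intros; eapply is_Cderive_continuous, is_Cderive_const).
assert (Hlin : segment_int (fun _ => g z) z w = (g z * (w - z))%C).
{ rewrite (segment_int_derive (fun x => g z * x)%C); [ring| |intros t _; apply Hconst].
  intros t _; eapply is_Cderive_eq.
  - apply is_Cderive_mult; [apply is_Cderive_const | apply is_Cderive_id].
  - simpl; ring. }
rewrite <- Hlin, <- segment_int_minus;
  [|now apply disk_segment_continuous | intros t _; apply Hconst].
rewrite Rmult_comm; apply segment_int_bound; intros t Ht.
- apply (continuous_minus (K := R_AbsRing) (V := C_R_NormedModule)); [|apply Hconst].
  now apply disk_segment_continuous.
- apply Rlt_le, Hg.
  replace (segment_point z w t - z)%C with (RtoC t * (w - z))%C by (unfold segment_point; ring).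
  rewrite Cmod_mult, Cmod_pos_real by lra; generalize (Cmod_ge_0 (w - z)); nra.
Qed.

End Primitive.

(** * The Bernardi transform *)

(** [f(z) / z] completed by its limit [f'(0) = 1]. At [0] only its continuity is established, which
    matches the hypotheses of the section [Primitive]. *)
Definition slope0 (f : C -> C) (z : C) : C :=
  if Ceq_dec z (RtoC 0) then RtoC 1 else (f z / z)%C.

Lemma analytic_is_Cderive (f : C -> C) (z : C) :
  analytic_disk f -> unit_disk z -> is_Cderive f z (C_derive f z).
Proof.
intros Hf Hz; destruct (Hf z Hz) as [l Hl].
now rewrite (is_C_derive_unique f z l Hl).
Qed.

Lemma H0_derive_0 (f : C -> C) : class_H0 f ->
  forall e, 0 < e -> exists d, 0 < d /\
    forall z, Cmod z < d -> Cmod (f z - z) <= e * Cmod z.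
Proof.
intros [Hf [H0 H1]] e He.
assert (Hd : is_Cderive f (RtoC 0) (RtoC 1)).
{ rewrite <- H1; apply analytic_is_Cderive; trivial; unfold unit_disk; rewrite Cmod_0; lra. }
rewrite is_Cderive_eps in Hd; destruct (Hd e He) as [d [Hd0 Hd1]].
exists d; split; trivial; intros z Hz; specialize (Hd1 z).
rewrite H0 in Hd1.
replace (z - 0)%C with z in Hd1 by ring.
replace (f z - 0 - 1 * z)%C with (f z - z)%C in Hd1 by ring; auto.
Qed.

Lemma slope0_near_0 (f : C -> C) : class_H0 f ->
  forall e, 0 < e -> exists d, 0 < d /\ forall z, Cmod z < d -> Cmod (slope0 f z - 1) <= e.
Proof.
intros Hf e He; destruct (H0_derive_0 f Hf e He) as [d [Hd H]].
exists d; split; trivial; intros z Hz; unfold slope0; destruct (Ceq_dec z 0) as [E|E].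
- replace (1 - 1)%C with (RtoC 0) by ring; rewrite Cmod_0; lra.
- assert (Hm := proj1 (Cmod_gt_0 z) E).
  replace (f z / z - 1)%C with ((f z - z) / z)%C by (field; trivial).
  rewrite Cmod_div by trivial; apply Rle_div_l; auto.
Qed.

Lemma locally_nonzero (z w : C) : Cmod (w - z) < Cmod z -> w <> RtoC 0.
Proof.
intros H ->; replace (0 - z)%C with (- z)%C in H by ring; rewrite Cmod_opp in H; lra.
Qed.

Lemma slope0_derivable (f : C -> C) (z : C) : class_H0 f -> unit_disk z -> z <> RtoC 0 ->
  exists l, is_Cderive (slope0 f) z l.
Proof.
intros [Hf _] Hz Hz0; eexists.
apply is_Cderive_ext_loc with (f := fun w => (f w / w)%C) (d := Cmod z).
- now apply Cmod_gt_0.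
- intros w Hw; unfold slope0; destruct (Ceq_dec w 0) as [E|E]; trivial.
  now apply locally_nonzero in Hw.
- apply is_Cderive_div; [trivial | now apply analytic_is_Cderive | apply is_Cderive_id].
Qed.

Lemma slope0_continuous (f : C -> C) (z : C) :
  class_H0 f -> unit_disk z -> Ccontinuous (slope0 f) z.
Proof.
intros Hf Hz; destruct (Ceq_dec z 0) as [->|E].
- apply Ccontinuous_eps; intros e He.
  destruct (slope0_near_0 f Hf (e / 2) ltac:(lra)) as [d [Hd H]].
  exists d; split; trivial; intros w Hw.
  replace (w - 0)%C with w in Hw by ring.
  unfold slope0 at 2; destruct (Ceq_dec 0 0) as [_|E]; [|easy].
  specialize (H w Hw); lra.
- destruct (slope0_derivable f z Hf Hz E) as [l Hl]; eapply is_Cderive_continuous; exact Hl.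
Qed.

(** Agrees with [z ^ c / z * f z] off the origin, and is continuous at the origin even for
    [c = 0]. *)
Definition bernardi_integrand (c : nat) (f : C -> C) (z : C) : C := (z ^ c * slope0 f z)%C.

Lemma is_Cderive_pow_S (n : nat) (z : C) :
  is_Cderive (fun x => x ^ S n)%C z (RtoC (INR (S n)) * z ^ n)%C.
Proof.
induction n.
- eapply is_Cderive_eq.
  + exact (is_Cderive_mult _ _ _ _ _ (is_Cderive_id z) (is_Cderive_const 1 z)).
  + simpl; ring.
- eapply is_Cderive_eq.
  + exact (is_Cderive_mult _ _ _ _ _ (is_Cderive_id z) IHn).
  + rewrite (S_INR (S n)), RtoC_plus; simpl; ring.
Qed.

Lemma Cpow_continuous (n : nat) (z : C) : Ccontinuous (fun x => x ^ n)%C z.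
Proof.
destruct n.
- exact (is_Cderive_continuous _ _ _ (is_Cderive_const 1 z)).
- eapply is_Cderive_continuous, is_Cderive_pow_S.
Qed.

Lemma Ccontinuous_mult (f g : C -> C) (z : C) :
  Ccontinuous f z -> Ccontinuous g z -> Ccontinuous (fun x => f x * g x)%C z.
Proof.
rewrite !Ccontinuous_eps; intros Hf Hg e He.
assert (H1 := Cmod_ge_0 (f z)); assert (H2 := Cmod_ge_0 (g z)).
set (K := Cmod (f z) + Cmod (g z) + 1).
assert (HK : 0 < K) by (unfold K; lra).
assert (He' : 0 < Rmin 1 (e / (2 * K))).
{ apply Rmin_pos; [lra|]; apply Rdiv_lt_0_compat; lra. }
destruct (Hf _ He') as [d1 [Hd1 Hf']], (Hg _ He') as [d2 [Hd2 Hg']].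
exists (Rmin d1 d2); split; [now apply Rmin_pos|]; intros w Hw.
specialize (Hf' w (Rlt_le_trans _ _ _ Hw (Rmin_l _ _))).
specialize (Hg' w (Rlt_le_trans _ _ _ Hw (Rmin_r _ _))).
replace (f w * g w - f z * g z)%C
  with ((f w - f z) * (g w - g z) + f z * (g w - g z) + (f w - f z) * g z)%C by ring.
eapply Rle_lt_trans; [apply Cmod_triangle|].
eapply Rle_lt_trans; [apply Rplus_le_compat_r, Cmod_triangle|].
rewrite !Cmod_mult.
assert (Hm1 := Rmin_l 1 (e / (2 * K))); assert (Hm2 := Rmin_r 1 (e / (2 * K))).
set (m := Rmin 1 (e / (2 * K))) in *.
assert (H3 := Cmod_ge_0 (f w - f z)); assert (H4 := Cmod_ge_0 (g w - g z)).
apply Rle_lt_trans with (m * K).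
- unfold K; nra.
- apply (Rmult_le_compat_r K) in Hm2; [|lra].
  replace (e / (2 * K) * K) with (e / 2) in Hm2 by (field; lra); lra.
Qed.

Definition bernardi_const (c : nat) : C := (RtoC 1 + RtoC (INR c))%C.

Lemma Cmod_bernardi_const (c : nat) : Cmod (bernardi_const c) = 1 + INR c.
Proof.
unfold bernardi_const; rewrite <- RtoC_plus; apply Cmod_pos_real; generalize (pos_INR c); lra.
Qed.

Section Bernardi.

Variables (c : nat) (f : C -> C).
Hypothesis Hf : class_H0 f.

Notation k := (bernardi_const c).

Lemma bernardi_integrand_continuous (z : C) :
  unit_disk z -> Ccontinuous (bernardi_integrand c f) z.
Proof.
intros Hz; apply Ccontinuous_mult; [apply Cpow_continuous | now apply slope0_continuous].
Qed.

Lemma bernardi_integrand_derivable (z : C) : unit_disk z -> z <> RtoC 0 ->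
  exists l, is_Cderive (bernardi_integrand c f) z l.
Proof.
intros Hz Hz0; destruct (slope0_derivable f z Hf Hz Hz0) as [l Hl]; eexists.
apply is_Cderive_mult; [now apply is_Cderive_pow | exact Hl].
Qed.

Lemma bernardi_segment_int (z : C) : z <> RtoC 0 ->
  bernardi c f z = (k / z ^ c * segment_int (bernardi_integrand c f) 0 z)%C.
Proof.
intros Hz; unfold bernardi; destruct (Ceq_dec z 0) as [E|_]; [easy|].
f_equal; apply (RInt_ext (V := C_R_CompleteNormedModule)); intros t Ht.
rewrite Rmin_left, Rmax_right in Ht by lra.
(* Only interior parameters have to be compared, so the division by [t z] is genuine. *)
assert (Ht0 : RtoC t <> RtoC 0) by (intros E; apply (f_equal Re) in E; simpl in E; lra).
assert (Htz : (RtoC t * z)%C <> RtoC 0) by now apply Cmult_neq_0.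
rewrite segment_point_0; unfold bernardi_integrand, slope0.
destruct (Ceq_dec (RtoC t * z) 0) as [E|_]; [easy|].
match goal with |- ?x = ?y => change (@eq C x y) end; field; now split.
Qed.

Lemma bernardi_const_neq_0 : k <> RtoC 0.
Proof.
unfold bernardi_const; intros E; apply (f_equal Re) in E; simpl in E; generalize (pos_INR c); lra.
Qed.

(** Product rule: the factor [k / z^c] contributes [- c F / z], and the primitive contributes
    [k f / z]. *)
Lemma bernardi_derive (z : C) : unit_disk z -> z <> RtoC 0 ->
  is_Cderive (bernardi c f) z ((k * f z - RtoC (INR c) * bernardi c f z) / z)%C.
Proof.
intros Hz Hz0.
assert (Hm := proj1 (Cmod_gt_0 z) Hz0).
apply is_Cderive_ext_loc
  with (f := fun z => (k / z ^ c * segment_int (bernardi_integrand c f) 0 z)%C) (d := Cmod z);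
  [exact Hm | |].
{ intros w Hw; symmetry; apply bernardi_segment_int; eapply locally_nonzero; exact Hw. }
assert (Hp := Cpow_nz z c Hz0).
eapply is_Cderive_eq.
- apply is_Cderive_mult.
  + apply is_Cderive_div; [exact Hp | apply is_Cderive_const | now apply is_Cderive_pow].
  + apply segment_int_primitive; trivial.
    * apply bernardi_integrand_continuous.
    * apply bernardi_integrand_derivable.
- rewrite bernardi_segment_int by trivial.
  unfold bernardi_integrand, slope0; destruct (Ceq_dec z 0) as [E|_]; [easy|].
  simpl; field; auto.
Qed.

(** The transform fixes the identity, because [k] times the integral of [zeta^c] is [z^c * z]. Hence
    [F(z) - z] is the transform of [f - id], whose integrand carries the small factor
    [slope0 f - 1]. *)
Lemma bernardi_near_0 :
  forall e, 0 < e -> exists d, 0 < d /\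
    forall z, Cmod z < d -> Cmod (bernardi c f z - z) <= e * Cmod z.
Proof.
intros e He.
assert (Hc := pos_INR c).
assert (He' : 0 < e / (1 + INR c)) by (apply Rdiv_lt_0_compat; lra).
destruct (slope0_near_0 f Hf _ He') as [d [Hd H]].
exists (Rmin d 1); split; [apply Rmin_pos; lra|].
intros z Hz.
assert (Hzd := Rlt_le_trans _ _ _ Hz (Rmin_l _ _)).
assert (Hz1 := Rlt_le_trans _ _ _ Hz (Rmin_r _ _)).
destruct (Ceq_dec z 0) as [->|Hz0].
{ unfold bernardi; destruct (Ceq_dec 0 0); [|easy].
  replace (0 - 0)%C with (RtoC 0) by ring; rewrite Cmod_0; lra. }
assert (Hm := proj1 (Cmod_gt_0 z) Hz0).
assert (Hp := Cpow_nz z c Hz0).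
assert (H0 : unit_disk 0) by (unfold unit_disk; rewrite Cmod_0; lra).
assert (Hseg : forall t, 0 <= t <= 1 -> Cmod (segment_point 0 z t) <= Cmod z).
{ intros t Ht; apply segment_point_Cmod_le; trivial; [rewrite Cmod_0 | ]; lra. }
assert (HcB : on_segment (Ccontinuous (bernardi_integrand c f)) 0 z)
  by (apply disk_segment_continuous; trivial; apply bernardi_integrand_continuous).
assert (HcP : on_segment (Ccontinuous (fun x => x ^ c)%C) 0 z)
  by (intros t _; apply Cpow_continuous).
assert (Hmono : segment_int (fun x => x ^ c)%C 0 z = (z ^ S c / k)%C).
{ rewrite (segment_int_derive (fun x => x ^ S c * / k)%C); trivial.
  - simpl; field; apply bernardi_const_neq_0.
  - intros t _; eapply is_Cderive_eq.
    + apply is_Cderive_mult; [apply is_Cderive_pow_S | apply is_Cderive_const].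
    + replace (RtoC (INR (S c))) with k by (rewrite S_INR, RtoC_plus; unfold bernardi_const; ring).
      simpl; field; apply bernardi_const_neq_0. }
assert (Hdiff : (bernardi c f z - z)%C
  = (k / z ^ c * segment_int (fun x => bernardi_integrand c f x - x ^ c)%C 0 z)%C).
{ rewrite segment_int_minus, Hmono, bernardi_segment_int by trivial.
  simpl; field; split; [apply bernardi_const_neq_0 | trivial]. }
rewrite Hdiff, Cmod_mult, Cmod_div, Cmod_pow by trivial.
assert (Hk := Cmod_bernardi_const c).
assert (HB : Cmod (segment_int (fun x => bernardi_integrand c f x - x ^ c)%C 0 z)
   <= Cmod (z - 0) * (Cmod z ^ c * (e / (1 + INR c)))).
{ apply segment_int_bound.
  - intros t Ht; apply (continuous_minus (K := R_AbsRing) (V := C_R_NormedModule));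
      [now apply HcB | now apply HcP].
  - intros t Ht; specialize (Hseg t Ht); unfold bernardi_integrand.
    replace (segment_point 0 z t ^ c * slope0 f (segment_point 0 z t) - segment_point 0 z t ^ c)%C
      with (segment_point 0 z t ^ c * (slope0 f (segment_point 0 z t) - 1))%C by ring.
    rewrite Cmod_mult, Cmod_pow; apply Rmult_le_compat.
    + apply pow_le, Cmod_ge_0.
    + apply Cmod_ge_0.
    + apply pow_incr; split; [apply Cmod_ge_0 | exact Hseg].
    + apply H; lra. }
replace (z - 0)%C with z in HB by ring.
rewrite Hk.
assert (Hpz : 0 < Cmod z ^ c) by now apply pow_lt.
apply Rle_trans with ((1 + INR c) / Cmod z ^ c * (Cmod z * (Cmod z ^ c * (e / (1 + INR c))))).
- apply Rmult_le_compat_l; [|exact HB].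
  apply Rlt_le, Rdiv_lt_0_compat; lra.
- right; field; split; lra.
Qed.

Lemma bernardi_0 : bernardi c f 0 = 0.
Proof. unfold bernardi; now destruct (Ceq_dec 0 0). Qed.

Lemma bernardi_derive_0 : is_Cderive (bernardi c f) (RtoC 0) (RtoC 1).
Proof.
apply is_Cderive_eps; intros e He; destruct (bernardi_near_0 e He) as [d [Hd H]].
exists d; split; trivial; intros z Hz; rewrite bernardi_0.
replace (z - 0)%C with z in * by ring.
replace (bernardi c f z - 0 - 1 * z)%C with (bernardi c f z - z)%C by ring; auto.
Qed.

Lemma bernardi_H0 : class_H0 (bernardi c f).
Proof.
split; [|split].
- intros z Hz; destruct (Ceq_dec z 0) as [->|E].
  + eexists; apply bernardi_derive_0.
  + eexists; now apply bernardi_derive.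
- apply bernardi_0.
- apply is_C_derive_unique, bernardi_derive_0.
Qed.

End Bernardi.

(** * Starlikeness *)

Lemma closed_set_away (B : C -> Prop) (p : C) :
  closed_set B -> ~ B p -> exists d, 0 < d /\ forall w, Cmod (w - p) < d -> ~ B w.
Proof.
intros HB Hp; apply NNPP; intros Hn; apply Hp, HB; intros e He.
apply NNPP; intros Hn2; apply Hn; exists e; split; trivial.
intros w Hw HBw; apply Hn2; now exists w.
Qed.

(** Here [- m] is the infimum of the moduli. If it were not attained, each point of a square would
    have a neighbourhood without elements of [B] of modulus close to [- m]; compactness makes the
    gap uniform, against the infimum. *)
Lemma closed_set_least_modulus (B : C -> Prop) :
  closed_set B -> (exists z, B z) -> exists z0, B z0 /\ forall z, B z -> Cmod z0 <= Cmod z.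
Proof.
intros HB [z1 Hz1].
destruct (completeness (fun s => exists z, B z /\ s = - Cmod z)) as [m [Hub Hlub]].
{ exists 0; intros s [z [_ ->]]; generalize (Cmod_ge_0 z); lra. }
{ exists (- Cmod z1); now exists z1. }
assert (Hge : forall z, B z -> - m <= Cmod z).
{ intros z Hz; assert (- Cmod z <= m) by (apply Hub; now exists z); lra. }
apply NNPP; intros Hn.
assert (Hnot : forall z, Cmod z <= - m -> ~ B z).
{ intros z Hz HBz; apply Hn; exists z; split; trivial; intros w Hw; specialize (Hge w Hw); lra. }
(* Points of modulus at most [- m] are away from [B] by closedness; near the others the modulus
   itself exceeds [- m + d]. The factor [2] leaves room for bounding the modulus by the sum of two
   coordinates. *)
assert (Hd : forall x y, exists d : posreal, forall w : C,
   Cmod (w - (x, y)) < 2 * d -> Cmod w < - m + d -> ~ B w).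
{ intros x y; destruct (Rle_lt_dec (Cmod (x, y)) (- m)) as [H|H].
  - destruct (closed_set_away B (x, y) HB (Hnot _ H)) as [d [Hd Hw]].
    assert (H2 : 0 < d / 2) by lra.
    exists (mkposreal _ H2); simpl; intros w Hw1 _; apply Hw; lra.
  - assert (H2 : 0 < (Cmod (x, y) + m) / 4) by lra.
    exists (mkposreal _ H2); simpl; intros w Hw1 Hw2.
    generalize (Cmod_triangle_rev (x, y) w); rewrite Cmod_minus_sym; lra. }
set (delta := fun x y => proj1_sig (constructive_indefinite_description _ (Hd x y))).
assert (Hdelta : forall x y (w : C),
   Cmod (w - (x, y)) < 2 * delta x y -> Cmod w < - m + delta x y -> ~ B w).
{ intros x y; unfold delta; now destruct (constructive_indefinite_description _ (Hd x y)). }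
set (K := - m + 1).
destruct (compactness_value_2d (- K) K (- K) K delta) as [d Hcomp].
assert (Hd0 := cond_pos d).
(* The bound [1] keeps the near-minimal point in the square of half-side [K]; the bound [d] puts it
   below the threshold of a gauge that covers it. *)
assert (Hex : exists z, B z /\ Cmod z < - m + Rmin d 1).
{ apply NNPP; intros Hno.
  assert (m <= m - Rmin d 1).
  { apply Hlub; intros s [z [Hz ->]].
    apply Rnot_lt_le; intros Hlt; apply Hno; exists z; split; trivial; lra. }
  assert (0 < Rmin d 1) by (apply Rmin_pos; lra); lra. }
destruct Hex as [z [Hz Hzm]].
assert (Hm1 := Rmin_l d 1); assert (Hm2 := Rmin_r d 1).
assert (Hx : - K <= Re z <= K).
{ apply Rabs_le_between; eapply Rle_trans; [apply re_le_Cmod | unfold K; lra]. }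
assert (Hy : - K <= Im z <= K).
{ apply Rabs_le_between; eapply Rle_trans; [apply im_le_Cmod | unfold K; lra]. }
apply (Hcomp (Re z) (Im z) Hx Hy); intros [u [v [_ [_ [H1 [H2 H3]]]]]].
refine (Hdelta u v z _ _ Hz); [|lra].
eapply Rle_lt_trans; [apply Cmod_le_sum|].
change (Rabs (Re z - u) + Rabs (Im z - v) < 2 * delta u v); lra.
Qed.

Lemma is_derive_pos_increases (f : R -> R) (t l : R) :
  is_derive f t l -> 0 < l -> exists d, 0 < d /\ forall s, t < s < t + d -> f t < f s.
Proof.
rewrite is_derive_R_eps; intros H Hl.
destruct (H (l / 2) ltac:(lra)) as [d [Hd Hf]]; exists d; split; trivial.
intros s Hs; specialize (Hf s); rewrite Rabs_pos_eq in Hf by lra.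
specialize (Hf ltac:(lra)); apply Rabs_le_between in Hf; nra.
Qed.

Lemma is_derive_Cmod_sqr (y : R -> C) (t : R) (d : C) :
  path_derive y t d ->
  is_derive (fun s => Cmod (y s) * Cmod (y s)) t (2 * Re (Cconj (y t) * d)).
Proof.
intros [H1 H2].
apply is_derive_ext with (fun s => Re (y s) * Re (y s) + Im (y s) * Im (y s)).
{ intros s; now rewrite Cmod_sqr. }
replace (2 * Re (Cconj (y t) * d)) with
  ((Re d * Re (y t) + Re (y t) * Re d) + (Im d * Im (y t) + Im (y t) * Im d))
  by (unfold Re, Im; simpl; ring).
apply (is_derive_plus (K := R_AbsRing) (V := R_NormedModule)); now apply Derive.is_derive_mult.
Qed.

Lemma Ccontinuous_minus (f g : C -> C) (z : C) :
  Ccontinuous f z -> Ccontinuous g z -> Ccontinuous (fun x => f x - g x)%C z.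
Proof. apply (continuous_minus (K := R_AbsRing) (V := C_R_NormedModule)). Qed.

Lemma Cmod_lt_locally (f g : C -> C) (z : C) :
  Ccontinuous f z -> Ccontinuous g z -> Cmod (f z) < Cmod (g z) ->
  exists d, 0 < d /\ forall w, Cmod (w - z) < d -> Cmod (f w) < Cmod (g w).
Proof.
rewrite !Ccontinuous_eps; intros Hf Hg Hlt.
set (e := (Cmod (g z) - Cmod (f z)) / 2).
assert (He : 0 < e) by (unfold e; lra).
destruct (Hf e He) as [d1 [Hd1 H1]], (Hg e He) as [d2 [Hd2 H2]].
exists (Rmin d1 d2); split; [now apply Rmin_pos|]; intros w Hw.
specialize (H1 w (Rlt_le_trans _ _ _ Hw (Rmin_l _ _))).
specialize (H2 w (Rlt_le_trans _ _ _ Hw (Rmin_r _ _))).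
generalize (Cmod_triangle_rev (f w) (f z)) (Cmod_triangle_rev (g z) (g w)).
rewrite (Cmod_minus_sym (g z)); unfold e in *; lra.
Qed.

(** Geometrically, the direction from a point of the circle of radius [M] to a point inside points
    strictly inwards. *)
Lemma Re_conj_lt (u v : C) (M : R) : Cmod u = M -> 0 < M -> Cmod v < M ->
  Re (Cconj u * (v - u)) < 0.
Proof.
intros Hu HM Hv.
replace (Re (Cconj u * (v - u))) with (Re (Cconj u * v) - Re (Cconj u * u))
  by (unfold Re, Im; simpl; ring).
rewrite Re_conj_self, Hu.
assert (H : Re (Cconj u * v) <= M * Cmod v).
{ rewrite <- Hu, <- (Cmod_conj u), <- Cmod_mult.
  eapply Rle_trans; [apply Rle_abs | apply re_le_Cmod]. }
nra.
Qed.

Lemma class_H0_continuous (h : C -> C) (z : C) : class_H0 h -> unit_disk z -> Ccontinuous h z.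
Proof.
intros [Hh _] Hz; eapply is_Cderive_continuous, analytic_is_Cderive; eauto.
Qed.

(* [|P - 1| < M] for [P = z F' / F], multiplied out so that it makes sense where [F = 0]. *)
Definition quotient_close (c : nat) (f : C -> C) (M : R) (z : C) : Prop :=
  Cmod (bernardi_const c * (f z - bernardi c f z)) < Cmod (RtoC M * bernardi c f z).

Lemma quotient_close_near_0 (c : nat) (f : C -> C) (M : R) : class_H0 f -> 0 < M <= 1 ->
  exists d, 0 < d /\ forall z, z <> RtoC 0 -> Cmod z < d -> quotient_close c f M z.
Proof.
intros Hf HM.
assert (Hc := pos_INR c).
(* With this [e], [k |f - F|] is at most [2 k e |z| = (M / 2) |z|], while [M |F|] is at least
   [M (1 - e) |z| >= (3 M / 4) |z|]. *)
set (e := M / (4 * (1 + INR c))).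
assert (He : 0 < e) by (apply Rdiv_lt_0_compat; lra).
assert (Hke : (1 + INR c) * e = M / 4) by (unfold e; field; lra).
assert (He4 : e <= / 4) by nra.
destruct (H0_derive_0 f Hf e He) as [d1 [Hd1 H1]].
destruct (bernardi_near_0 c f Hf e He) as [d2 [Hd2 H2]].
exists (Rmin d1 d2); split; [now apply Rmin_pos|]; intros z Hz0 Hz.
specialize (H1 z (Rlt_le_trans _ _ _ Hz (Rmin_l _ _))).
specialize (H2 z (Rlt_le_trans _ _ _ Hz (Rmin_r _ _))).
assert (Hm := proj1 (Cmod_gt_0 z) Hz0).
unfold quotient_close; rewrite !Cmod_mult, Cmod_bernardi_const, Cmod_pos_real by lra.
assert (H3 : Cmod (f z - bernardi c f z) <= 2 * e * Cmod z).
{ generalize (Cmod_minus_triangle (f z) z (bernardi c f z)); rewrite (Cmod_minus_sym z); lra. }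
assert (H4 : (1 - e) * Cmod z <= Cmod (bernardi c f z)).
{ generalize (Cmod_triangle_rev z (bernardi c f z)); rewrite (Cmod_minus_sym z); lra. }
apply Rle_lt_trans with ((1 + INR c) * (2 * e * Cmod z)).
- apply Rmult_le_compat_l; lra.
- replace ((1 + INR c) * (2 * e * Cmod z)) with (M / 2 * Cmod z)
    by (replace (M / 2) with (2 * ((1 + INR c) * e)) by lra; ring).
  apply Rlt_le_trans with (M * ((1 - e) * Cmod z)); [|apply Rmult_le_compat_l; lra].
  rewrite <- Rmult_assoc; apply Rmult_lt_compat_r; nra.
Qed.

(* [P - 1] for [P = z F' / F], in a form that does not mention [F']. *)
Definition quotient_defect (c : nat) (f : C -> C) (z : C) : C :=
  (bernardi_const c * (f z - bernardi c f z) / bernardi c f z)%C.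

Lemma quotient_close_neq_0 (c : nat) (f : C -> C) (M : R) (z : C) :
  quotient_close c f M z -> bernardi c f z <> RtoC 0.
Proof.
unfold quotient_close; intros H E; rewrite E, Cmult_0_r, Cmod_0 in H.
generalize (Cmod_ge_0 (bernardi_const c * (f z - 0))); lra.
Qed.

Lemma quotient_close_defect (c : nat) (f : C -> C) (M : R) (z : C) :
  0 < M -> quotient_close c f M z -> Cmod (quotient_defect c f z) < M.
Proof.
intros HM H; assert (HF := quotient_close_neq_0 c f M z H).
unfold quotient_defect; rewrite Cmod_div by trivial.
apply Rlt_div_l; [now apply Cmod_gt_0|].
unfold quotient_close in H; rewrite (Cmod_mult (RtoC M)), Cmod_pos_real in H by lra; exact H.
Qed.

Lemma quotient_defect_shift (c : nat) (f : C -> C) (z : C) : bernardi c f z <> RtoC 0 ->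
  (bernardi_const c + quotient_defect c f z)%C = (bernardi_const c * f z / bernardi c f z)%C.
Proof. intros H; unfold quotient_defect; field; trivial. Qed.

(* [z P' = (c + P) (p - P)] for [p = z f' / f]. *)
Lemma quotient_defect_derive (c : nat) (f : C -> C) (z : C) :
  class_H0 f -> unit_disk z -> z <> RtoC 0 -> f z <> RtoC 0 -> bernardi c f z <> RtoC 0 ->
  is_Cderive (quotient_defect c f) z
    ((bernardi_const c + quotient_defect c f z)
     * (z * C_derive f z / f z - 1 - quotient_defect c f z) / z)%C.
Proof.
intros Hf Hz Hz0 Hfz HF.
eapply is_Cderive_eq.
- apply is_Cderive_div; [trivial | | now apply bernardi_derive].
  apply is_Cderive_mult; [apply is_Cderive_const|].
  apply is_Cderive_minus; [apply analytic_is_Cderive; [apply Hf | trivial] |].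
  now apply bernardi_derive.
- replace (z * C_derive f z / f z - 1 - quotient_defect c f z)%C
    with (z * C_derive f z / f z - (bernardi_const c + quotient_defect c f z)
          + (bernardi_const c - 1))%C by ring.
  rewrite quotient_defect_shift by trivial; simpl.
  replace (RtoC (INR c)) with (bernardi_const c - 1)%C by (unfold bernardi_const; ring).
  field; auto.
Qed.

Section Starlike.

Variables (c : nat) (f : C -> C) (M : R).
Hypothesis HM : 0 < M <= 1.
Hypothesis Hf : class_S M f.

Notation k := (bernardi_const c).
Notation F := (bernardi c f).

Lemma class_S_H0 : class_H0 f.
Proof. apply Hf. Qed.

Lemma quotient_close_sides_continuous (z : C) : unit_disk z ->
  Ccontinuous (fun z => k * (f z - F z))%C z /\ Ccontinuous (fun z => RtoC M * F z)%C z.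
Proof.
intros Hz.
assert (Hcst : forall a, Ccontinuous (fun _ => a) z)
  by (intros; eapply is_Cderive_continuous, is_Cderive_const).
assert (HF : Ccontinuous F z) by (apply class_H0_continuous; [apply bernardi_H0, class_S_H0 | trivial]).
split; apply Ccontinuous_mult; trivial.
apply Ccontinuous_minus; trivial; apply class_H0_continuous; [apply class_S_H0 | trivial].
Qed.

(** The failures that remain after discarding a neighbourhood of [0] form a closed set, since the
    condition is an open one; a failure of least modulus is then a case of equality. *)
Lemma first_failure (z1 : C) : unit_disk z1 -> z1 <> RtoC 0 -> ~ quotient_close c f M z1 ->
  exists z0, unit_disk z0 /\ z0 <> RtoC 0 /\ Cmod (k * (f z0 - F z0)) = Cmod (RtoC M * F z0) /\
    forall z, z <> RtoC 0 -> Cmod z < Cmod z0 -> quotient_close c f M z.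
Proof.
intros Hz1 Hz10 Hbad.
destruct (quotient_close_near_0 c f M class_S_H0 HM) as [d [Hd Hnear]].
(* At [0] both sides of the condition vanish and it fails, hence the lower bound [d] on the
   modulus. *)
set (B := fun z => Cmod z <= Cmod z1 /\ d <= Cmod z /\ ~ quotient_close c f M z).
destruct (closed_set_least_modulus B) as [z0 [[H1 [H2 H3]] Hmin]].
- intros z Hz; split; [|split].
  + apply le_epsilon; intros e He; destruct (Hz e He) as [w [[Hw _] Hwz]].
    generalize (Cmod_triangle_rev z w); rewrite Cmod_minus_sym; lra.
  + apply le_epsilon; intros e He; destruct (Hz e He) as [w [[_ [Hw _]] Hwz]].
    generalize (Cmod_triangle_rev w z); lra.
  + intros Hgood.
    assert (Hzd : unit_disk z).
    { apply Rle_lt_trans with (Cmod z1); [|exact Hz1].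
      apply le_epsilon; intros e He; destruct (Hz e He) as [w [[Hw _] Hwz]].
      generalize (Cmod_triangle_rev z w); rewrite Cmod_minus_sym; lra. }
    destruct (quotient_close_sides_continuous z Hzd) as [C1 C2].
    destruct (Cmod_lt_locally _ _ z C1 C2 Hgood) as [r [Hr Hloc]].
    destruct (Hz r Hr) as [w [[_ [_ Hw]] Hwz]]; now apply Hw, Hloc.
- exists z1; split; [lra|split; trivial].
  apply Rnot_lt_le; intros H; now apply Hbad, Hnear.
- assert (Hz0 : z0 <> RtoC 0) by (apply Cmod_gt_0; lra).
  assert (Hz0d : unit_disk z0) by (eapply Rle_lt_trans; [exact H1 | exact Hz1]).
  assert (Hin : forall z, z <> RtoC 0 -> Cmod z < Cmod z0 -> quotient_close c f M z).
  { intros z Hz Hzz; apply NNPP; intros Hn.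
    assert (HBz : B z).
    { split; [lra|split; trivial]; apply Rnot_lt_le; intros H; now apply Hn, Hnear. }
    specialize (Hmin z HBz); lra. }
  exists z0; repeat split; trivial.
  apply Rle_antisym; [|now apply Rnot_lt_le].
  (* A strict violation would persist at [(1 - s) z0], which has smaller modulus and so satisfies
     the condition. *)
  apply Rnot_lt_le; intros Hlt.
  destruct (quotient_close_sides_continuous z0 Hz0d) as [C1 C2].
  destruct (Cmod_lt_locally _ _ z0 C2 C1 Hlt) as [r [Hr Hloc]].
  set (s := Rmin (/ 2) (r / 2)).
  assert (Hs0 : 0 < s) by (apply Rmin_pos; lra).
  assert (Hs1 : s <= / 2) by apply Rmin_l.
  assert (Hs2 : s <= r / 2) by apply Rmin_r.
  set (w := (RtoC (1 - s) * z0)%C).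
  assert (Hm := proj1 (Cmod_gt_0 z0) Hz0); unfold unit_disk in Hz0d.
  assert (Hw : Cmod w = (1 - s) * Cmod z0) by (unfold w; rewrite Cmod_mult, Cmod_pos_real; lra).
  assert (Hwz : Cmod (w - z0) < r).
  { replace (w - z0)%C with (- (RtoC s * z0))%C by (unfold w; rewrite RtoC_minus; ring).
    rewrite Cmod_opp, Cmod_mult, Cmod_pos_real by lra; nra. }
  assert (Hgood : quotient_close c f M w).
  { apply Hin; [apply Cmod_gt_0|]; rewrite Hw; nra. }
  specialize (Hloc w Hwz); unfold quotient_close in Hgood; lra.
Qed.

(** [Re (k + w) >= 1 + c - 1 >= 0], and equality forces [c = 0] and [w = -1], that is
    [k + w = 0]. *)
Lemma Re_shifted_pos (w : C) : Cmod w <= 1 -> (k + w)%C <> RtoC 0 -> 0 < Re (k + w).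
Proof.
intros Hw Hne.
assert (Hc := pos_INR c).
assert (Hs := Cmod_sqr w); assert (Hm := Cmod_ge_0 w).
replace (Re (k + w)) with (1 + INR c + Re w) by (unfold bernardi_const, Re, Im; simpl; ring).
apply Rnot_le_lt; intros Hle; apply Hne.
assert (Hr : -1 <= Re w).
{ assert (H := re_le_Cmod w); apply Rabs_le_between in H; lra. }
apply C_eq; [unfold bernardi_const, Re, Im in *; simpl; lra|].
assert (Im w = 0) by nra.
unfold bernardi_const, Re, Im in *; simpl; lra.
Qed.

(* At a first failure [|P - 1| = M], and moving from [z0] in the direction
   [- z0 * conj (c + P)] decreases [|z|] but increases [|P - 1|], since
   [z P' = (c + P) (p - P)] and [|p - 1| < M]. *)
Theorem bernardi_quotient_close (z1 : C) : unit_disk z1 -> z1 <> RtoC 0 -> quotient_close c f M z1.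
Proof.
intros Hz1 Hz10; apply NNPP; intros Hbad.
destruct (first_failure z1 Hz1 Hz10 Hbad) as [z [Hz [Hz0 [Heq Hin]]]].
assert (Hfne := proj1 (proj2 Hf)); assert (HSM := proj2 (proj2 Hf)).
specialize (Hfne z Hz Hz0); specialize (HSM z Hz).
unfold starlike_quotient in HSM; destruct (Ceq_dec z 0) as [E|_]; [easy|].
assert (Hk := bernardi_const_neq_0 c).
assert (HF0 : F z <> RtoC 0).
{ intros E; rewrite E, !Cmod_mult, Cmod_0, Rmult_0_r in Heq.
  replace (f z - 0)%C with (f z) in Heq by ring.
  apply Rmult_integral in Heq; destruct Heq as [H|H]; apply Cmod_eq_0 in H; easy. }
set (w := quotient_defect c f).
set (p := (z * C_derive f z / f z)%C) in *.
assert (Hwz : Cmod (w z) = M).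
{ unfold w, quotient_defect; rewrite Cmod_div, Heq, Cmod_mult, Cmod_pos_real by (trivial; lra).
  field; now apply Rgt_not_eq, Cmod_gt_0. }
assert (Hkw : (k + w z)%C = (k * f z / F z)%C) by now apply quotient_defect_shift.
assert (Hkw0 : (k + w z)%C <> RtoC 0).
{ rewrite Hkw; intros E; apply (Cmult_neq_0 k (f z)); trivial.
  transitivity (k * f z / F z * F z)%C; [field; trivial | rewrite E; ring]. }
assert (Hre : 0 < Re (k + w z)) by (apply Re_shifted_pos; trivial; lra).
assert (Hw' : is_Cderive w z ((k + w z) * (p - 1 - w z) / z)%C)
  by (apply quotient_defect_derive; trivial; apply class_S_H0).
(* The conjugate turns the factor [k + w] of [w'] into the real number [|k + w|^2], so the
   derivative of [|w|^2] has the sign of [- Re (conj w (p - 1 - w))]. It also makes the derivative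
   of [- |y|^2] equal to [2 |z|^2 Re (k + w)]. Both are positive. *)
set (h := (- (z * Cconj (k + w z)))%C).
set (y := fun t => (z + RtoC t * h)%C).
assert (Hy0 : y 0 = z) by (unfold y; ring).
assert (Hy : path_derive y 0 h).
{ assert (H := path_derive_segment z (z + h) 0).
  replace (z + h - z)%C with h in H by ring.
  unfold segment_point in H; replace (z + h - z)%C with h in H by ring; exact H. }
assert (Hnorm : is_derive (fun t => Cmod (w (y t)) * Cmod (w (y t))) 0
  (- 2 * (Cmod (k + w z) * Cmod (k + w z)) * Re (Cconj (w z) * ((p - 1) - w z)))).
{ assert (Hp : path_derive (fun t => w (y t)) 0 ((k + w z) * (p - 1 - w z) / z * h)%C)
    by (apply path_derive_comp; [rewrite Hy0 | ]; trivial).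
  apply is_derive_Cmod_sqr in Hp; rewrite Hy0 in Hp.
  replace (- 2 * (Cmod (k + w z) * Cmod (k + w z)) * Re (Cconj (w z) * ((p - 1) - w z)))
    with (2 * Re (Cconj (w z) * ((k + w z) * (p - 1 - w z) / z * h))); trivial.
  unfold h.
  replace (Cconj (w z) * ((k + w z) * (p - 1 - w z) / z * - (z * Cconj (k + w z))))%C
    with (- (((k + w z) * Cconj (k + w z)) * (Cconj (w z) * (p - 1 - w z))))%C
    by (field; trivial).
  rewrite <- Cmod2_conj, re_opp, re_scal_l; ring. }
assert (Hinner : is_derive (fun t => - (Cmod (y t) * Cmod (y t))) 0
  (2 * (Cmod z * Cmod z) * Re (k + w z))).
{ assert (H := is_derive_Cmod_sqr _ _ _ Hy); rewrite Hy0 in H.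
  apply (is_derive_opp (K := R_AbsRing) (V := R_NormedModule)) in H.
  replace (2 * (Cmod z * Cmod z) * Re (k + w z)) with (opp (2 * Re (Cconj z * h))); trivial.
  change (- (2 * Re (Cconj z * h)) = 2 * (Cmod z * Cmod z) * Re (k + w z)).
  unfold h; replace (Cconj z * - (z * Cconj (k + w z)))%C
    with (- ((z * Cconj z) * Cconj (k + w z)))%C by ring.
  rewrite <- Cmod2_conj, re_opp, re_scal_l, re_conj; ring. }
assert (Hm := proj1 (Cmod_gt_0 z) Hz0).
assert (Hkm := proj1 (Cmod_gt_0 _) Hkw0).
assert (Hneg := Re_conj_lt (w z) (p - 1) M Hwz (proj1 HM) HSM).
destruct (is_derive_pos_increases _ _ _ Hnorm) as [d1 [Hd1 H1]].
{ assert (0 < Cmod (k + w z) * Cmod (k + w z)) by now apply Rmult_lt_0_compat. nra. }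
destruct (is_derive_pos_increases _ _ _ Hinner) as [d2 [Hd2 H2]].
{ assert (0 < Cmod z * Cmod z) by now apply Rmult_lt_0_compat. nra. }
destruct (proj1 (path_continuous_eps y 0) (path_derive_continuous _ _ _ Hy) _ Hm)
  as [d3 [Hd3 H3]].
set (t := Rmin d1 (Rmin d2 d3) / 2).
assert (Hmin : 0 < Rmin d1 (Rmin d2 d3)) by (repeat apply Rmin_pos; trivial).
assert (Ht1 := Rmin_l d1 (Rmin d2 d3)); assert (Ht23 := Rmin_r d1 (Rmin d2 d3)).
assert (Ht2 := Rmin_l d2 d3); assert (Ht3 := Rmin_r d2 d3).
specialize (H1 t ltac:(unfold t; lra)); specialize (H2 t ltac:(unfold t; lra)).
specialize (H3 t); rewrite Rminus_0_r, Rabs_pos_eq in H3 by (unfold t; lra).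
specialize (H3 ltac:(unfold t; lra)); rewrite Hy0 in *.
assert (Hyt0 : y t <> RtoC 0) by (now apply locally_nonzero with z).
assert (Hyt : Cmod (y t) < Cmod z).
{ assert (Hp := Cmod_ge_0 (y t)); nra. }
specialize (Hin _ Hyt0 Hyt).
assert (Hw : Cmod (w (y t)) < M) by now apply quotient_close_defect.
rewrite Hwz in H1; generalize (Cmod_ge_0 (w (y t))); nra.
Qed.

End Starlike.

(** * Convexity *)

(** [M_bound c] is the positive root of [M^2 + 2 c M = 1], whose left side increases with
    [M > 0]. *)
Lemma M_bound_spec (c : nat) (M : R) : 0 < M <= M_bound c -> M * M + 2 * INR c * M <= 1.
Proof.
intros [H0 H]; unfold M_bound in H.
assert (Hc := pos_INR c).
assert (Hs : sqrt (INR c ^ 2 + 1) * sqrt (INR c ^ 2 + 1) = INR c ^ 2 + 1)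
  by (apply sqrt_sqrt; nra).
nra.
Qed.

Lemma M_bound_pos (c : nat) : 0 < M_bound c.
Proof.
unfold M_bound.
assert (Hc := pos_INR c).
assert (Hs : sqrt (INR c ^ 2 + 1) * sqrt (INR c ^ 2 + 1) = INR c ^ 2 + 1)
  by (apply sqrt_sqrt; nra).
assert (H0 := sqrt_pos (INR c ^ 2 + 1)); nra.
Qed.

(* The extremal case is [p = 1 - M], [P = 1 + M]. *)
Lemma Re_quotient_ge (p P : C) (M : R) :
  0 < M <= / 2 -> Cmod (p - 1) <= M -> Cmod (P - 1) <= M ->
  (1 - M) * (Cmod P * Cmod P) <= (1 + M) * Re (p * Cconj P).
Proof.
intros HM Hp HP.
assert (H1 : Re P - M * Cmod P <= Re (p * Cconj P)).
{ replace (Re (p * Cconj P)) with (Re P + Re ((p - 1) * Cconj P))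
    by (unfold Re, Im; simpl; ring).
  assert (H := re_le_Cmod ((p - 1) * Cconj P)); rewrite Cmod_mult, Cmod_conj in H.
  apply Rabs_le_between in H; assert (H0 := Cmod_ge_0 P); nra. }
assert (H2 : Cmod P * Cmod P + 1 - M * M <= 2 * Re P).
{ assert (H : Cmod (P - 1) * Cmod (P - 1) <= M * M)
    by (apply Rmult_le_compat; trivial; apply Cmod_ge_0).
  rewrite Cmod_sqr in *.
  replace (Re (P - 1)) with (Re P - 1) in H by (unfold Re; simpl; ring).
  replace (Im (P - 1)) with (Im P) in H by (unfold Im; simpl; ring); lra. }
assert (H3 : Cmod P <= 1 + M).
{ generalize (Cmod_triangle_rev P 1); rewrite Cmod_1; lra. }
assert (H4 := Cmod_ge_0 P).
set (r := Cmod P) in *.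
(* [H1] and [H2] reduce the claim to [(1 + M) (r^2 + 1 - M^2 - 2 M r) - 2 (1 - M) r^2 >= 0]. This
   factors through its root [r = 1 + M], the extremal modulus; [M <= 1 / 2] makes the other factor
   nonnegative. *)
assert (H5 : 0 <= (1 + M - r) * ((1 + M) * (1 - M) - (3 * M - 1) * r)).
{ apply Rmult_le_pos; [lra|].
  destruct (Rle_dec (3 * M) 1); nra. }
nra.
Qed.

Lemma convexity_inequality (c : nat) (p P : C) (M : R) :
  0 < M <= 1 -> M * M + 2 * INR c * M <= 1 -> Cmod (p - 1) < M -> Cmod (P - 1) < M ->
  0 < Re (p * (RtoC (INR c) + P) / P - RtoC (INR c)).
Proof.
intros HM Hc Hp HP.
assert (HP0 : P <> RtoC 0).
{ intros ->; replace (0 - 1)%C with (- (1))%C in HP by ring.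
  rewrite Cmod_m1 in HP; lra. }
assert (Hrp : 1 - M < Re p).
{ assert (H := re_le_Cmod (p - 1)); apply Rabs_le_between in H.
  replace (Re (p - 1)) with (Re p - 1) in H by (unfold Re; simpl; ring); lra. }
assert (HmP := proj1 (Cmod_gt_0 P) HP0).
assert (HmPP : 0 < Cmod P * Cmod P) by now apply Rmult_lt_0_compat.
assert (Hconj : Cconj P <> RtoC 0) by (apply Cmod_gt_0; now rewrite Cmod_conj).
assert (Hdiv : (p / P)%C = (RtoC (/ (Cmod P * Cmod P)) * (p * Cconj P))%C).
{ rewrite RtoC_inv by lra.
  replace (RtoC (Cmod P * Cmod P)) with (P * Cconj P)%C
    by (rewrite <- Cmod2_conj; f_equal; ring).
  field; now split. }
(* The form [p + c (p / P - 1)] isolates [p / P], whose real part is at least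
   [(1 - M) / (1 + M)]. *)
replace (p * (RtoC (INR c) + P) / P - RtoC (INR c))%C
  with (p + (RtoC (INR c) * (p / P) - RtoC (INR c)))%C by (field; trivial).
rewrite re_plus; unfold Cminus; rewrite re_plus, re_opp, re_RtoC, re_scal_l, Hdiv, re_scal_l.
(* For [c = 0] only [Re p > 1 - M] is left. For [c >= 1] the hypothesis gives [M^2 + 2 M <= 1],
   hence the [M <= 1 / 2] required by [Re_quotient_ge]. *)
destruct c as [|c']; [simpl; lra|].
assert (Hc1 : 1 <= INR (S c')) by (rewrite S_INR; generalize (pos_INR c'); lra).
set (c := INR (S c')) in *.
assert (HM2 : M <= / 2) by nra.
assert (H := Re_quotient_ge p P M ltac:(lra) ltac:(lra) ltac:(lra)).
assert (Hq : (1 - M) / (1 + M) <= / (Cmod P * Cmod P) * Re (p * Cconj P)).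
{ apply Rle_div_l; [lra|].
  apply Rmult_le_reg_l with (Cmod P * Cmod P); trivial.
  replace (Cmod P * Cmod P * (/ (Cmod P * Cmod P) * Re (p * Cconj P) * (1 + M)))
    with ((1 + M) * Re (p * Cconj P)) by (field; lra); lra. }
assert (Hfin : 0 <= 1 - M + (c * ((1 - M) / (1 + M)) - c)).
{ replace (1 - M + (c * ((1 - M) / (1 + M)) - c)) with ((1 - (M * M + 2 * c * M)) / (1 + M))
    by (field; lra).
  apply Rle_div_r; lra. }
apply (Rmult_le_compat_l c) in Hq; lra.
Qed.

Section Convex.

Variables (c : nat) (f : C -> C) (M : R).
Hypothesis HM : 0 < M <= 1.
Hypothesis HMc : M * M + 2 * INR c * M <= 1.
Hypothesis Hf : class_S M f.

Notation k := (bernardi_const c).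
Notation F := (bernardi c f).

Lemma bernardi_neq_0 (z : C) : unit_disk z -> z <> RtoC 0 -> F z <> RtoC 0.
Proof.
intros Hz Hz0; apply quotient_close_neq_0 with M.
now apply bernardi_quotient_close.
Qed.

Lemma bernardi_C_derive (z : C) : unit_disk z -> z <> RtoC 0 ->
  C_derive F z = ((k * f z - RtoC (INR c) * F z) / z)%C.
Proof.
intros Hz Hz0; apply is_C_derive_unique, bernardi_derive; trivial.
now apply class_S_H0 with M.
Qed.

Lemma bernardi_C_derive_defect (z : C) : unit_disk z -> z <> RtoC 0 ->
  C_derive F z = (F z * (1 + quotient_defect c f z) / z)%C.
Proof.
intros Hz Hz0; rewrite bernardi_C_derive by trivial.
assert (HF := bernardi_neq_0 z Hz Hz0).
unfold quotient_defect.
replace (RtoC (INR c)) with (k - 1)%C by (unfold bernardi_const; ring).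
field; now split.
Qed.

(** Differentiating [z F' = k f - c F] gives [z F'' = k f' - (c + 1) F'], and [c + 1 = k]. *)
Lemma bernardi_C_derive_2 (z : C) : unit_disk z -> z <> RtoC 0 ->
  C_derive (C_derive F) z = (k * (C_derive f z - C_derive F z) / z)%C.
Proof.
intros Hz Hz0; apply is_C_derive_unique.
assert (Hf0 : class_H0 f) by now apply class_S_H0 with M.
assert (Hm := proj1 (Cmod_gt_0 z) Hz0); assert (Hz' := Hz); unfold unit_disk in Hz'.
apply is_Cderive_ext_loc
  with (f := fun z => ((k * f z - RtoC (INR c) * F z) / z)%C) (d := Rmin (Cmod z) (1 - Cmod z)).
- apply Rmin_pos; lra.
- intros w Hw; symmetry; apply bernardi_C_derive.
  + assert (H := Rlt_le_trans _ _ _ Hw (Rmin_r _ _)); unfold unit_disk.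
    generalize (Cmod_triangle_rev w z); lra.
  + apply locally_nonzero with z; exact (Rlt_le_trans _ _ _ Hw (Rmin_l _ _)).
- eapply is_Cderive_eq.
  + apply is_Cderive_div; [trivial | | apply is_Cderive_id].
    apply is_Cderive_minus; (apply is_Cderive_mult; [apply is_Cderive_const|]).
    * apply analytic_is_Cderive; [apply Hf0 | trivial].
    * now apply bernardi_derive.
  + rewrite bernardi_C_derive by trivial; simpl.
    replace (RtoC (INR c)) with (k - 1)%C by (unfold bernardi_const; ring).
    field; trivial.
Qed.

Lemma bernardi_convex (z : C) : unit_disk z ->
  C_derive F z <> RtoC 0 /\
  0 < Re (RtoC 1 + z * C_derive (C_derive F) z / C_derive F z)%C.
Proof.
intros Hz; destruct (Ceq_dec z 0) as [->|Hz0].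
{ assert (H0 := bernardi_H0 c f (class_S_H0 f M Hf)).
  rewrite (proj2 (proj2 H0)); split.
  - intros E; apply (f_equal Re) in E; simpl in E; lra.
  (* The factor [z = 0] annihilates [C_derive (C_derive F) 0], so the value at the origin is [1]
     whatever that term is. *)
  - replace (1 + 0 * C_derive (C_derive F) 0 / 1)%C with (RtoC 1) by field.
    rewrite re_RtoC; lra. }
assert (HF := bernardi_neq_0 z Hz Hz0).
assert (Hfz := proj1 (proj2 Hf) z Hz Hz0).
assert (Hp := proj2 (proj2 Hf) z Hz).
unfold starlike_quotient in Hp; destruct (Ceq_dec z 0) as [E|_]; [easy|].
set (p := (z * C_derive f z / f z)%C) in *.
set (P := (1 + quotient_defect c f z)%C).
assert (HP : Cmod (P - 1) < M).
{ unfold P; replace (1 + quotient_defect c f z - 1)%C with (quotient_defect c f z) by ring.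
  apply quotient_close_defect; [lra | now apply bernardi_quotient_close]. }
assert (HP0 : P <> RtoC 0).
{ intros E; rewrite E in HP; replace (0 - 1)%C with (- (1))%C in HP by ring.
  rewrite Cmod_m1 in HP; lra. }
assert (HF' : C_derive F z = (F z * P / z)%C) by now apply bernardi_C_derive_defect.
assert (HF'0 : C_derive F z <> RtoC 0).
{ intros E; apply (Cmult_neq_0 (F z) P); trivial.
  transitivity (F z * P / z * z)%C; [field; trivial | rewrite <- HF', E; ring]. }
split; trivial.
rewrite bernardi_C_derive_2 by trivial.
replace (1 + z * (k * (C_derive f z - C_derive F z) / z) / C_derive F z)%C
  with (p * (RtoC (INR c) + P) / P - RtoC (INR c))%C.
{ now apply convexity_inequality with M. }
replace (RtoC (INR c) + P)%C with (k * f z / F z)%C.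
{ replace (C_derive f z) with (p * f z / z)%C by (unfold p; field; now split).
  rewrite HF'.
  replace (RtoC (INR c)) with (k - 1)%C by (unfold bernardi_const; ring).
  field; auto. }
rewrite <- quotient_defect_shift by trivial; unfold P, bernardi_const; ring.
Qed.

End Convex.

(** * Complex exponentials and lifts *)

Definition Cexp (z : C) : C := (exp (Re z) * cos (Im z), exp (Re z) * sin (Im z)).

Lemma Cexp_plus (z w : C) : Cexp (z + w) = (Cexp z * Cexp w)%C.
Proof.
unfold Cexp; rewrite re_plus, im_plus, exp_plus, cos_plus, sin_plus.
apply C_eq; unfold Re, Im; simpl; ring.
Qed.

Lemma Cexp_0 : Cexp 0 = 1.
Proof. unfold Cexp; simpl; rewrite exp_0, cos_0, sin_0; apply C_eq; simpl; ring. Qed.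

Lemma Cmod_Cexp (z : C) : Cmod (Cexp z) = exp (Re z).
Proof.
assert (H := Cmod_sqr (Cexp z)).
change (Re (Cexp z)) with (exp (Re z) * cos (Im z)) in H.
change (Im (Cexp z)) with (exp (Re z) * sin (Im z)) in H.
assert (He := exp_pos (Re z)); assert (Hm := Cmod_ge_0 (Cexp z)).
assert (Hsc := sin2_cos2 (Im z)); unfold Rsqr in Hsc.
assert (Heq : Cmod (Cexp z) * Cmod (Cexp z) = exp (Re z) * exp (Re z)).
{ rewrite H; transitivity (exp (Re z) * exp (Re z)
    * (sin (Im z) * sin (Im z) + cos (Im z) * cos (Im z))); [ring | rewrite Hsc; ring]. }
nra.
Qed.

Lemma Cexp_neq_0 (z : C) : Cexp z <> RtoC 0.
Proof. apply Cmod_gt_0; rewrite Cmod_Cexp; apply exp_pos. Qed.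

Lemma Cexp_opp (z : C) : Cexp (- z) = (/ Cexp z)%C.
Proof.
assert (H : (Cexp (- z) * Cexp z = 1)%C).
{ rewrite <- Cexp_plus; replace (- z + z)%C with (RtoC 0) by ring; apply Cexp_0. }
transitivity (Cexp (- z) * Cexp z / Cexp z)%C; [|rewrite H]; field; apply Cexp_neq_0.
Qed.

Lemma Cexp_surjective (u : C) : u <> RtoC 0 -> exists d, Cexp d = u.
Proof.
intros Hu; assert (Hm := proj1 (Cmod_gt_0 u) Hu).
assert (Hs := Cmod_sqr u).
set (m := Cmod u) in *.
assert (Hx : -1 <= Re u / m <= 1).
{ split; [apply Rle_div_r | apply Rle_div_l]; trivial;
    assert (H := re_le_Cmod u); apply Rabs_le_between in H; fold m in H; lra. }
set (th := acos (Re u / m)).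
assert (Hcos : m * cos th = Re u) by (unfold th; rewrite cos_acos by lra; field; lra).
assert (Hsin : m * sin th = Rabs (Im u)).
{ assert (H0 : 0 <= sin th) by (apply sin_ge_0; apply acos_bound).
  assert (H1 := sin2_cos2 th); unfold Rsqr in H1.
  assert (H2 : (m * sin th) * (m * sin th) = Rabs (Im u) * Rabs (Im u)).
  { replace (Rabs (Im u) * Rabs (Im u)) with (Im u * Im u)
      by (rewrite <- Rabs_mult; symmetry; apply Rabs_pos_eq; nra).
    replace (Im u * Im u) with (m * m - Re u * Re u) by lra.
    rewrite <- Hcos; replace (m * m) with (m * m * (sin th * sin th + cos th * cos th))
      by (rewrite H1; ring); ring. }
  apply Rsqr_inj; [nra | apply Rabs_pos | exact H2]. }
assert (Hexp : exp (ln m) = m) by now apply exp_ln.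
destruct (Rle_dec 0 (Im u)) as [Hi|Hi].
- exists (ln m, th); unfold Cexp; simpl; rewrite Hexp.
  rewrite Rabs_pos_eq in Hsin by trivial; now apply C_eq.
- exists (ln m, - th); unfold Cexp; simpl; rewrite Hexp, cos_neg, sin_neg.
  rewrite Rabs_left in Hsin by lra; apply C_eq; simpl; lra.
Qed.

Lemma Cexp_1_small (z : C) : Cexp z = 1 -> Cmod z <= 1 -> z = 0.
Proof.
intros H Hz.
assert (Hre : Re z = 0).
{ apply exp_inv; rewrite exp_0, <- Cmod_Cexp, H; apply Cmod_1. }
apply C_eq; [exact Hre|]; simpl.
assert (Hcos : cos (Im z) = 1).
{ apply (f_equal Re) in H; unfold Cexp in H; simpl in H.
  rewrite Hre, exp_0 in H; lra. }
assert (Hi : Rabs (Im z) <= 1) by (eapply Rle_trans; [apply im_le_Cmod | exact Hz]).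
assert (Hcosa : cos (Rabs (Im z)) = 1).
{ unfold Rabs; destruct (Rcase_abs (Im z)); [now rewrite cos_neg | trivial]. }
destruct (Rle_lt_or_eq_dec _ _ (Rabs_pos (Im z))) as [Hp|Hp].
- assert (HPI := PI2_1).
  assert (Hlt : cos (Rabs (Im z)) < cos 0) by (apply cos_decreasing_1; lra).
  rewrite cos_0 in Hlt; lra.
- destruct (Req_dec (Im z) 0) as [E|E]; trivial.
  apply Rabs_pos_lt in E; lra.
Qed.

Lemma path_derive_Cexp (y : R -> C) (t : R) (l : C) :
  path_derive y t l -> path_derive (fun s => Cexp (y s)) t (l * Cexp (y t))%C.
Proof.
intros [H1 H2].
assert (He : is_derive (fun s => exp (Re (y s))) t (Re l * exp (Re (y t)))).
{ apply (is_derive_comp (K := R_AbsRing) (V := R_NormedModule)); trivial; apply is_derive_exp. }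
assert (Hc : is_derive (fun s => cos (Im (y s))) t (Im l * - sin (Im (y t)))).
{ apply (is_derive_comp (K := R_AbsRing) (V := R_NormedModule)); trivial; apply is_derive_cos. }
assert (Hs : is_derive (fun s => sin (Im (y s))) t (Im l * cos (Im (y t)))).
{ apply (is_derive_comp (K := R_AbsRing) (V := R_NormedModule)); trivial; apply is_derive_sin. }
split.
- replace (Re (l * Cexp (y t))) with (Re l * exp (Re (y t)) * cos (Im (y t))
     + exp (Re (y t)) * (Im l * - sin (Im (y t)))) by (unfold Cexp, Re, Im; simpl; ring).
  exact (Derive.is_derive_mult _ _ _ _ _ He Hc).
- replace (Im (l * Cexp (y t))) with (Re l * exp (Re (y t)) * sin (Im (y t))
     + exp (Re (y t)) * (Im l * cos (Im (y t)))) by (unfold Cexp, Re, Im; simpl; ring).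
  exact (Derive.is_derive_mult _ _ _ _ _ He Hs).
Qed.

(** * Logarithms along paths *)

Definition clamp (t : R) : R := Rmax 0 (Rmin 1 t).

Lemma clamp_id (t : R) : 0 <= t <= 1 -> clamp t = t.
Proof. intros H; unfold clamp; rewrite Rmin_right, Rmax_right; lra. Qed.

Lemma clamp_bounds (t : R) : 0 <= clamp t <= 1.
Proof.
unfold clamp; split; [apply Rmax_l | apply Rmax_lub; [lra | apply Rmin_l]].
Qed.

Lemma clamp_lipschitz (s t : R) : Rabs (clamp s - clamp t) <= Rabs (s - t).
Proof.
assert (H : forall r, r <= 0 /\ clamp r = 0 \/ 0 <= r <= 1 /\ clamp r = r \/ 1 <= r /\ clamp r = 1).
{ intros r; unfold clamp; destruct (Rle_dec r 0); [|destruct (Rle_dec r 1)].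
  - left; rewrite Rmin_right, Rmax_left; lra.
  - right; left; rewrite Rmin_right, Rmax_right; lra.
  - right; right; rewrite Rmin_left, Rmax_right; lra. }
destruct (H s) as [[Hs ->]|[[Hs ->]|[Hs ->]]], (H t) as [[Ht ->]|[[Ht ->]|[Ht ->]]];
  unfold Rabs; repeat destruct Rcase_abs; lra.
Qed.

(* Clamping keeps the integrand defined and continuous beyond the endpoints, so that the
   primitive has two-sided derivatives on all of [[0, 1]]. *)
Definition clamped_primitive (h : R -> C) (t : R) : C := CRInt (fun s => h (clamp s)) 0 t.

Lemma clamped_primitive_derive (h : R -> C) :
  (forall t, 0 <= t <= 1 -> path_continuous h t) ->
  forall t, 0 <= t <= 1 -> path_derive (clamped_primitive h) t (h t).
Proof.
intros Hh t Ht.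
assert (Hc : forall s, path_continuous (fun s => h (clamp s)) s).
{ intros s; apply path_continuous_eps; intros e He.
  destruct (proj1 (path_continuous_eps h (clamp s)) (Hh _ (clamp_bounds s)) e He) as [d [Hd H]].
  exists d; split; trivial; intros u Hu; apply H.
  eapply Rle_lt_trans; [apply clamp_lipschitz | exact Hu]. }
assert (Hint : forall b, is_CRInt (fun s => h (clamp s)) 0 b (clamped_primitive h b)).
{ intros b; apply (RInt_correct (V := C_R_CompleteNormedModule)).
  apply (ex_RInt_continuous (V := C_R_CompleteNormedModule)); intros s _; apply Hc. }
rewrite <- (clamp_id t Ht) at 2.
split.
- apply (is_derive_RInt (V := R_NormedModule) (fun s => Re (h (clamp s))) _ 0).
  + apply filter_forall; intros b.
    apply (is_RInt_fct_extend_fst (U := R_NormedModule) (V := R_NormedModule) _ _ _ _ (Hint b)).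
  + apply (continuous_comp (fun s => h (clamp s)) (fst : C_UniformSpace -> R_UniformSpace));
      [apply Hc | apply continuous_fst].
- apply (is_derive_RInt (V := R_NormedModule) (fun s => Im (h (clamp s))) _ 0).
  + apply filter_forall; intros b.
    apply (is_RInt_fct_extend_snd (U := R_NormedModule) (V := R_NormedModule) _ _ _ _ (Hint b)).
  + apply (continuous_comp (fun s => h (clamp s)) (snd : C_UniformSpace -> R_UniformSpace));
      [apply Hc | apply continuous_snd].
Qed.

(** For [h = y' / y] this is the increment of a continuous logarithm of [y] over [[0, 1]]. *)
Definition log_increment (h : R -> C) : C := clamped_primitive h 1.

Lemma clamped_primitive_0 (h : R -> C) : clamped_primitive h 0 = 0.
Proof. apply (RInt_point (V := C_R_CompleteNormedModule)). Qed.

(** [y] times the exponential of minus the primitive of [h] has derivative [0]. *)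
Lemma log_increment_exp (y h : R -> C) :
  (forall t, 0 <= t <= 1 -> path_continuous h t) ->
  (forall t, 0 <= t <= 1 -> path_derive y t (y t * h t)%C) ->
  y 1 = (y 0 * Cexp (log_increment h))%C.
Proof.
intros Hh Hy.
set (D := fun t => (y t * Cexp (- clamped_primitive h t))%C).
destruct (path_mean_value D (fun _ => RtoC 0) 0 1) as [t [_ H]]; [lra| |].
{ intros t Ht; eapply path_derive_eq.
  - apply path_derive_mult; [now apply Hy|].
    apply path_derive_Cexp, path_derive_opp, clamped_primitive_derive; trivial.
  - simpl; ring. }
rewrite Cmod_0, Rmult_0_l in H.
assert (HD : D 1 = D 0).
{ assert (E : (D 1 - D 0 = 0)%C) by (apply Cmod_eq_0, Rle_antisym; trivial; apply Cmod_ge_0).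
  transitivity (D 1 - D 0 + D 0)%C; [ring | rewrite E; ring]. }
unfold D in HD; rewrite clamped_primitive_0, Cexp_opp in HD.
replace (- (0))%C with (RtoC 0) in HD by ring; rewrite Cexp_0 in HD.
fold (log_increment h) in HD.
transitivity (y 1 * / Cexp (log_increment h) * Cexp (log_increment h))%C.
- field; apply Cexp_neq_0.
- rewrite HD; ring.
Qed.

(** Bounding by the value at one parameter, instead of by a supremum, lets pointwise estimates be
    used directly; in [log_increment_bound] it also preserves strict inequalities. *)
Lemma log_increment_diff (h1 h2 : R -> C) :
  (forall t, 0 <= t <= 1 -> path_continuous h1 t) ->
  (forall t, 0 <= t <= 1 -> path_continuous h2 t) ->
  exists t, 0 <= t <= 1 /\ Cmod (log_increment h1 - log_increment h2) <= Cmod (h1 t - h2 t).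
Proof.
intros H1 H2.
destruct (path_mean_value (fun t => clamped_primitive h1 t + - clamped_primitive h2 t)%C
   (fun t => h1 t + - h2 t)%C 0 1) as [t [Ht H]]; [lra| |].
{ intros t Ht; apply path_derive_plus; [|apply path_derive_opp];
    now apply clamped_primitive_derive. }
exists t; split; trivial.
rewrite !clamped_primitive_0, Rminus_0_r, Rmult_1_r in H.
unfold log_increment, Cminus.
replace (clamped_primitive h1 1 + - clamped_primitive h2 1)%C with
  (clamped_primitive h1 1 + - clamped_primitive h2 1 - (0 + - (0)))%C by ring; exact H.
Qed.

Lemma log_increment_bound (h : R -> C) :
  (forall t, 0 <= t <= 1 -> path_continuous h t) ->
  exists t, 0 <= t <= 1 /\ Cmod (log_increment h) <= Cmod (h t).
Proof.
intros H.
destruct (path_mean_value (clamped_primitive h) h 0 1) as [t [Ht Hle]]; [lra| |].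
{ intros t Ht; now apply clamped_primitive_derive. }
exists t; split; trivial.
rewrite clamped_primitive_0, Rminus_0_r, Rmult_1_r in Hle.
replace (log_increment h) with (clamped_primitive h 1 - 0)%C by (unfold log_increment; ring).
exact Hle.
Qed.

(* March from [X] to [0] in steps so short that [|D| <= 1] persists, where [exp] is injective. *)
Lemma Cexp_lift_constant (D : R -> C) (L X : R) :
  0 <= L -> X <= 0 -> (forall x, x <= 0 -> Cexp (D x) = 1) ->
  (forall x x', x <= x' <= 0 -> Cmod (D x' - D x) <= L * (x' - x)) ->
  Cmod (D X) <= 1 -> D 0 = 0.
Proof.
intros HL HX Hexp Hlip H0.
assert (Hstep : forall n : nat, D (Rmin 0 (X + INR n / (L + 1))) = 0).
{ induction n.
  - simpl; replace (X + 0 / (L + 1)) with X by (field; lra).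
    rewrite Rmin_right by trivial; apply Cexp_1_small; auto.
  - set (x := Rmin 0 (X + INR n / (L + 1))) in *.
    set (x' := Rmin 0 (X + INR (S n) / (L + 1))).
    assert (Hinv : 0 < / (L + 1)) by (apply Rinv_0_lt_compat; lra).
    assert (Hx : x <= x' <= 0 /\ x' - x <= / (L + 1)).
    { unfold x, x'; rewrite S_INR.
      replace ((INR n + 1) / (L + 1)) with (INR n / (L + 1) + / (L + 1)) by (field; lra).
      unfold Rmin; destruct (Rle_dec 0 _), (Rle_dec 0 _); lra. }
    apply Cexp_1_small; [apply Hexp; lra|].
    specialize (Hlip x x' (proj1 Hx)); rewrite IHn in Hlip.
    replace (D x' - 0)%C with (D x') in Hlip by ring.
    eapply Rle_trans; [exact Hlip|].
    apply Rle_trans with (L * / (L + 1)); [apply Rmult_le_compat_l; lra|].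
    apply Rle_div_l; lra. }
destruct (INR_unbounded (- X * (L + 1))) as [n Hn].
specialize (Hstep n); rewrite Rmin_left in Hstep; trivial.
apply Rmult_lt_compat_r with (r := / (L + 1)) in Hn; [|apply Rinv_0_lt_compat; lra].
rewrite Rmult_assoc, Rinv_r, Rmult_1_r in Hn by lra.
unfold Rdiv; lra.
Qed.

(** * Univalence *)

(** The modulus along the spiral is [|z| exp (t Re d)], monotone in [t], so it stays below the
    larger of its end values. *)
Lemma Cmod_spiral_lt (z d : C) (t : R) :
  unit_disk z -> unit_disk (z * Cexp d) -> 0 <= t <= 1 -> unit_disk (z * Cexp (RtoC t * d)).
Proof.
unfold unit_disk; rewrite !Cmod_mult, !Cmod_Cexp, re_scal_l; intros H1 H2 Ht.
assert (H0 := Cmod_ge_0 z).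
destruct (Rle_dec 0 (Re d)) as [Hd|Hd].
- apply Rle_lt_trans with (2 := H2); apply Rmult_le_compat_l; trivial.
  destruct (Req_dec (t * Re d) (Re d)) as [->|E]; [lra|].
  apply Rlt_le, exp_increasing; nra.
- apply Rle_lt_trans with (2 := H1); rewrite <- (Rmult_1_r (Cmod z)) at 2.
  apply Rmult_le_compat_l; trivial; rewrite <- exp_0.
  destruct (Req_dec (t * Re d) 0) as [->|E]; [lra|].
  apply Rlt_le, exp_increasing; nra.
Qed.

Section Univalent.

Variables (c : nat) (f : C -> C) (M : R).
Hypothesis HM : 0 < M <= 1.
Hypothesis Hf : class_S M f.

Notation k := (bernardi_const c).
Notation F := (bernardi c f).
Notation Q := (quotient_defect c f).

(** The derivative is written [l / z] because [l], the derivative of [Q] with respect to [log z], is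
    bounded uniformly on the punctured disk, even near the origin. *)
Lemma defect_derive (z : C) : unit_disk z -> z <> RtoC 0 -> exists l,
  is_Cderive Q z (l / z)%C /\ Cmod l <= (1 + INR c + M) * (2 * M).
Proof.
intros Hz Hz0; eexists; split.
{ apply quotient_defect_derive; trivial.
  - now apply class_S_H0 with M.
  - now apply Hf.
  - now apply bernardi_neq_0 with M. }
assert (HQ : Cmod (Q z) < M).
{ apply quotient_close_defect; [lra | now apply bernardi_quotient_close]. }
assert (Hp := proj2 (proj2 Hf) z Hz).
unfold starlike_quotient in Hp; destruct (Ceq_dec z 0) as [E|_]; [easy|].
rewrite Cmod_mult; apply Rmult_le_compat; try apply Cmod_ge_0.
- eapply Rle_trans; [apply Cmod_triangle|]; rewrite Cmod_bernardi_const; lra.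
- unfold Cminus at 1; eapply Rle_trans; [apply Cmod_triangle|]; rewrite Cmod_opp; lra.
Qed.

(** In the variable [s] with point [exp s * z], the derivative of [Q] is the bounded [l] of
    [defect_derive]. *)
Lemma defect_radial_lipschitz (z : C) (x x' : R) : unit_disk z -> z <> RtoC 0 -> x <= x' <= 0 ->
  Cmod (Q (RtoC (exp x') * z) - Q (RtoC (exp x) * z)) <= (1 + INR c + M) * (2 * M) * (x' - x).
Proof.
intros Hz Hz0 [Hx Hx'].
destruct (Rle_lt_or_eq_dec _ _ Hx) as [Hlt | ->].
2:{ replace (Q (RtoC (exp x') * z) - Q (RtoC (exp x') * z))%C with (RtoC 0) by ring.
    rewrite Cmod_0; lra. }
assert (Hd : forall s, x <= s <= x' -> unit_disk (RtoC (exp s) * z) /\ (RtoC (exp s) * z)%C <> RtoC 0).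
{ intros s Hs; assert (He := exp_pos s).
  split.
  - unfold unit_disk in *; rewrite Cmod_mult, Cmod_pos_real by lra.
    assert (exp s <= 1).
    { rewrite <- exp_0; destruct (Req_dec s 0) as [->|E]; [lra|].
      apply Rlt_le, exp_increasing; lra. }
    generalize (Cmod_ge_0 z); nra.
  - apply Cmult_neq_0; trivial; intros E; apply (f_equal Re) in E; simpl in E; lra. }
destruct (path_mean_value (fun s => Q (RtoC (exp s) * z)%C)
  (fun s => (C_derive Q (RtoC (exp s) * z) * (RtoC (exp s) * z))%C) x x' Hlt) as [s [Hs H]].
{ intros s Hs; destruct (Hd s Hs) as [H1 H2].
  destruct (defect_derive _ H1 H2) as [l [Hl _]].
  rewrite (is_C_derive_unique _ _ _ Hl).
  apply path_derive_comp with (y := fun s => (RtoC (exp s) * z)%C); [exact Hl|].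
  eapply path_derive_eq.
  - apply path_derive_mult; [apply path_derive_RtoC, is_derive_exp | apply path_derive_const].
  - simpl; ring. }
eapply Rle_trans; [exact H|]; apply Rmult_le_compat_r; [lra|].
destruct (Hd s Hs) as [H1 H2].
destruct (defect_derive _ H1 H2) as [l [Hl Hle]].
rewrite (is_C_derive_unique _ _ _ Hl).
replace (l / (RtoC (exp s) * z) * (RtoC (exp s) * z))%C with l; [exact Hle|].
set (u := (RtoC (exp s) * z)%C) in *; field; trivial.
Qed.

(* [log (phi (e^x z e^d)) - log (phi (e^x z))] for [phi = F / id], computed along a logarithmic
   spiral; recall that [z phi' / phi = P - 1]. *)
Definition spiral_increment (z d : C) (x : R) : C :=
  log_increment (fun t => Q (RtoC (exp x) * (z * Cexp (RtoC t * d))) * d)%C.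

Section Spiral.

Variables z d : C.
Hypothesis Hz : unit_disk z.
Hypothesis Hz0 : z <> RtoC 0.
Hypothesis Hzd : unit_disk (z * Cexp d).

Lemma spiral_point (x t : R) : x <= 0 -> 0 <= t <= 1 ->
  let y := (RtoC (exp x) * (z * Cexp (RtoC t * d)))%C in unit_disk y /\ y <> RtoC 0.
Proof.
intros Hx Ht y; assert (He := exp_pos x); split.
- assert (H := Cmod_spiral_lt z d t Hz Hzd Ht); unfold y, unit_disk in *.
  rewrite Cmod_mult, Cmod_pos_real by lra.
  assert (exp x <= 1).
  { rewrite <- exp_0; destruct (Req_dec x 0) as [->|E]; [lra|].
    apply Rlt_le, exp_increasing; lra. }
  generalize (Cmod_ge_0 (z * Cexp (RtoC t * d))); nra.
- apply Cmult_neq_0; [|apply Cmult_neq_0; trivial; apply Cexp_neq_0].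
  intros E; apply (f_equal Re) in E; simpl in E; lra.
Qed.

Lemma spiral_derive (x t : R) :
  path_derive (fun t => RtoC (exp x) * (z * Cexp (RtoC t * d)))%C t
    (d * (RtoC (exp x) * (z * Cexp (RtoC t * d))))%C.
Proof.
eapply path_derive_eq.
- apply path_derive_mult; [apply path_derive_const|].
  apply path_derive_mult; [apply path_derive_const|].
  apply path_derive_Cexp, path_derive_mult; [|apply path_derive_const].
  apply (path_derive_RtoC (fun s => s)), (is_derive_id (K := R_AbsRing)).
- change (one : R_AbsRing) with 1; simpl; ring.
Qed.

Lemma spiral_defect_continuous (x t : R) : x <= 0 -> 0 <= t <= 1 ->
  path_continuous (fun t => Q (RtoC (exp x) * (z * Cexp (RtoC t * d))) * d)%C t.
Proof.
intros Hx Ht; destruct (spiral_point x t Hx Ht) as [H1 H2].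
destruct (defect_derive _ H1 H2) as [l [Hl _]].
eapply path_derive_continuous, path_derive_mult; [|apply path_derive_const].
exact (path_derive_comp Q (fun t => RtoC (exp x) * (z * Cexp (RtoC t * d)))%C t _ _
  Hl (spiral_derive x t)).
Qed.

Lemma spiral_increment_exp (x : R) : x <= 0 ->
  let y := (RtoC (exp x) * z)%C in
  (F (y * Cexp d) / (y * Cexp d) = F y / y * Cexp (spiral_increment z d x))%C.
Proof.
intros Hx y.
set (phi := fun w => (F w / w)%C).
set (s := fun t => (RtoC (exp x) * (z * Cexp (RtoC t * d)))%C).
assert (H := log_increment_exp (fun t => phi (s t)) (fun t => Q (s t) * d)%C).
replace (y * Cexp d)%C with (s 1) by (unfold s, y; replace (1 * d)%C with d by ring; ring).
replace y with (s 0) by (unfold s, y; replace (0 * d)%C with (RtoC 0) by ring; rewrite Cexp_0; ring).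
apply H.
- intros t Ht; now apply spiral_defect_continuous.
- intros t Ht; destruct (spiral_point x t Hx Ht) as [H1 H2].
  assert (HF := bernardi_neq_0 c f M HM Hf _ H1 H2).
  eapply path_derive_eq.
  + refine (path_derive_comp phi s t _ _ _ (spiral_derive x t)).
    apply is_Cderive_div; [exact H2 | | apply is_Cderive_id].
    apply bernardi_derive; trivial; now apply class_S_H0 with M.
  + unfold phi, quotient_defect; fold (s t); fold (s t) in HF, H2.
    replace (RtoC (INR c)) with (k - 1)%C by (unfold bernardi_const; ring).
    field; now split.
Qed.

Lemma spiral_increment_lipschitz (x x' : R) : x <= x' <= 0 ->
  Cmod (spiral_increment z d x' - spiral_increment z d x)
  <= (1 + INR c + M) * (2 * M) * Cmod d * (x' - x).
Proof.
intros Hx.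
destruct (log_increment_diff
  (fun t => Q (RtoC (exp x') * (z * Cexp (RtoC t * d))) * d)%C
  (fun t => Q (RtoC (exp x) * (z * Cexp (RtoC t * d))) * d)%C) as [t [Ht H]].
{ intros t Ht; apply spiral_defect_continuous; lra. }
{ intros t Ht; apply spiral_defect_continuous; lra. }
eapply Rle_trans; [exact H|].
set (w := (z * Cexp (RtoC t * d))%C).
replace (Q (RtoC (exp x') * w) * d - Q (RtoC (exp x) * w) * d)%C
  with ((Q (RtoC (exp x') * w) - Q (RtoC (exp x) * w)) * d)%C by ring.
rewrite Cmod_mult.
replace ((1 + INR c + M) * (2 * M) * Cmod d * (x' - x))
  with ((1 + INR c + M) * (2 * M) * (x' - x) * Cmod d) by ring.
apply Rmult_le_compat_r; [apply Cmod_ge_0|].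
apply defect_radial_lipschitz; trivial.
- now apply Cmod_spiral_lt.
- apply Cmult_neq_0; trivial; apply Cexp_neq_0.
Qed.

(** The integrand is [Q d] with [|Q| < M <= 1]: the logarithm of [F / id] is a strict contraction in
    the logarithmic variable. *)
Lemma spiral_increment_lt (x : R) : x <= 0 -> d <> RtoC 0 ->
  Cmod (spiral_increment z d x) < Cmod d.
Proof.
intros Hx Hd.
destruct (log_increment_bound (fun t => Q (RtoC (exp x) * (z * Cexp (RtoC t * d))) * d)%C)
  as [t [Ht H]].
{ intros t Ht; now apply spiral_defect_continuous. }
eapply Rle_lt_trans; [exact H|]; rewrite Cmod_mult.
destruct (spiral_point x t Hx Ht) as [H1 H2].
assert (HQ : Cmod (Q (RtoC (exp x) * (z * Cexp (RtoC t * d)))) < M).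
{ apply quotient_close_defect; [lra | now apply bernardi_quotient_close]. }
assert (Hm := proj1 (Cmod_gt_0 d) Hd); nra.
Qed.

(** As [x] decreases the spiral shrinks to the origin, where the condition holds with any [m] in
    place of [M]; then [|Q d| <= m |d| <= e]. *)
Lemma spiral_increment_vanishes (e : R) : 0 < e ->
  exists X, X <= 0 /\ forall x, x <= X -> Cmod (spiral_increment z d x) <= e.
Proof.
intros He; assert (Hd := Cmod_ge_0 d).
set (m := Rmin 1 (e / (Cmod d + 1))).
assert (Hm : 0 < m) by (apply Rmin_pos; [lra | apply Rdiv_lt_0_compat; lra]).
assert (Hm1 : m <= 1) by apply Rmin_l.
assert (Hm2 : m <= e / (Cmod d + 1)) by apply Rmin_r.
destruct (quotient_close_near_0 c f m) as [r [Hr Hnear]].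
{ now apply class_S_H0 with M. }
{ lra. }
exists (Rmin 0 (ln r)); split; [apply Rmin_l|]; intros x Hx.
assert (Hx0 := Rle_trans _ _ _ Hx (Rmin_l _ _)); assert (Hxr := Rle_trans _ _ _ Hx (Rmin_r _ _)).
destruct (log_increment_bound (fun t => Q (RtoC (exp x) * (z * Cexp (RtoC t * d))) * d)%C)
  as [t [Ht H]].
{ intros t Ht; now apply spiral_defect_continuous. }
eapply Rle_trans; [exact H|]; rewrite Cmod_mult.
destruct (spiral_point x t Hx0 Ht) as [H1 H2].
assert (HQ : Cmod (Q (RtoC (exp x) * (z * Cexp (RtoC t * d)))) < m).
{ apply quotient_close_defect; [lra|]; apply Hnear; trivial.
  assert (Hs := Cmod_spiral_lt z d t Hz Hzd Ht); unfold unit_disk in Hs.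
  assert (Hex := exp_pos x); rewrite Cmod_mult, Cmod_pos_real by lra.
  assert (exp x <= r).
  { rewrite <- (exp_ln r) by trivial; destruct (Req_dec x (ln r)) as [->|E]; [lra|].
    apply Rlt_le, exp_increasing; lra. }
  assert (Hs0 := Cmod_ge_0 (z * Cexp (RtoC t * d))); nra. }
apply (Rmult_le_compat_r (Cmod d + 1)) in Hm2; [|lra].
replace (e / (Cmod d + 1) * (Cmod d + 1)) with e in Hm2 by (field; lra); nra.
Qed.

End Spiral.

(** At each [x] the two increments are logarithms of the same ratio, so the exponential of their
    difference is [1]. The difference is Lipschitz in [x] and small for very negative [x], hence it
    vanishes all the way up to [x = 0]. *)
Lemma spiral_increment_unique (z d d' : C) :
  unit_disk z -> z <> RtoC 0 -> unit_disk (z * Cexp d) -> Cexp d = Cexp d' ->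
  spiral_increment z d 0 = spiral_increment z d' 0.
Proof.
intros Hz Hz0 Hzd Hdd'.
assert (Hzd' : unit_disk (z * Cexp d')) by now rewrite <- Hdd'.
set (D := fun x => (spiral_increment z d x - spiral_increment z d' x)%C).
destruct (spiral_increment_vanishes z d Hz Hz0 Hzd (/ 2) ltac:(lra)) as [X1 [HX1 H1]].
destruct (spiral_increment_vanishes z d' Hz Hz0 Hzd' (/ 2) ltac:(lra)) as [X2 [HX2 H2]].
assert (HD : D 0 = 0).
{ assert (Hc := pos_INR c); assert (Hd := Cmod_ge_0 d); assert (Hd' := Cmod_ge_0 d').
  set (L := (1 + INR c + M) * (2 * M)).
  assert (HL : 0 <= L) by (apply Rmult_le_pos; lra).
  apply Cexp_lift_constant with (L := L * (Cmod d + Cmod d')) (X := Rmin X1 X2).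
  - apply Rmult_le_pos; lra.
  - eapply Rle_trans; [apply Rmin_l | exact HX1].
  - intros x Hx; unfold D, Cminus; rewrite Cexp_plus, Cexp_opp.
    assert (E1 := spiral_increment_exp z d Hz Hz0 Hzd x Hx).
    assert (E2 := spiral_increment_exp z d' Hz Hz0 Hzd' x Hx).
    cbv zeta in E1, E2; rewrite <- Hdd', E1 in E2.
    destruct (spiral_point z d Hz Hz0 Hzd x 0 Hx ltac:(lra)) as [Hy Hy0].
    replace (RtoC (exp x) * (z * Cexp (0 * d)))%C with (RtoC (exp x) * z)%C in Hy, Hy0
      by (replace (0 * d)%C with (RtoC 0) by ring; rewrite Cexp_0; ring).
    set (y := (RtoC (exp x) * z)%C) in *.
    assert (HF := bernardi_neq_0 c f M HM Hf y Hy Hy0).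
    assert (E : Cexp (spiral_increment z d x) = Cexp (spiral_increment z d' x)).
    { transitivity (F y / y * Cexp (spiral_increment z d x) * (y / F y))%C;
        [|rewrite E2]; field; now split. }
    rewrite E; apply Cinv_r, Cexp_neq_0.
  - intros x x' Hx.
    replace (D x' - D x)%C with
      ((spiral_increment z d x' - spiral_increment z d x)
       + - (spiral_increment z d' x' - spiral_increment z d' x))%C by (unfold D; ring).
    eapply Rle_trans; [apply Cmod_triangle|]; rewrite Cmod_opp.
    assert (L1 := spiral_increment_lipschitz z d Hz Hz0 Hzd x x' Hx).
    assert (L2 := spiral_increment_lipschitz z d' Hz Hz0 Hzd' x x' Hx).
    fold L in L1, L2; lra.
  - unfold D, Cminus; eapply Rle_trans; [apply Cmod_triangle|]; rewrite Cmod_opp.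
    specialize (H1 _ (Rmin_l X1 X2)); specialize (H2 _ (Rmin_r X1 X2)); lra. }
transitivity (D 0 + spiral_increment z d' 0)%C; [unfold D; ring | rewrite HD; ring].
Qed.

Lemma bernardi_univalent : univalent_disk F.
Proof.
intros z1 z2 Hz1 Hz2 HF.
assert (F0 : F 0 = 0) by apply bernardi_0.
destruct (Ceq_dec z1 0) as [->|Hz10].
{ destruct (Ceq_dec z2 0) as [->|Hz20]; trivial.
  now apply (bernardi_neq_0 c f M HM Hf) in Hz20; [rewrite <- HF in Hz20|]. }
destruct (Ceq_dec z2 0) as [->|Hz20].
{ now apply (bernardi_neq_0 c f M HM Hf) in Hz10; [rewrite HF in Hz10|]. }
assert (HF1 := bernardi_neq_0 c f M HM Hf z1 Hz1 Hz10).
destruct (Cexp_surjective (z2 / z1)) as [d0 Hd0].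
{ intros E; apply Hz20; transitivity (z2 / z1 * z1)%C; [field; trivial | rewrite E; ring]. }
assert (Hend : (z1 * (z2 / z1))%C = z2) by (field; trivial).
(* Equal values of [F] make the ratio of [F / id] between the ends equal to [z1 / z2], so minus its
   logarithm is again a logarithm of [z2 / z1]. Replacing [d0] by this [d] leaves the increment
   equal to [- d], against [spiral_increment_lt] unless [d = 0]. *)
set (d := (- spiral_increment z1 d0 0)%C).
assert (Hd : Cexp d = (z2 / z1)%C).
{ unfold d; rewrite Cexp_opp.
  assert (E := spiral_increment_exp z1 d0 Hz1 Hz10 ltac:(now rewrite Hd0, Hend) 0 ltac:(lra)).
  cbv zeta in E; rewrite exp_0, Cmult_1_l, Hd0, Hend, <- HF in E.
  set (u := Cexp (spiral_increment z1 d0 0)) in *.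
  assert (Hu : u <> RtoC 0) by apply Cexp_neq_0.
  replace u with (z1 / z2)%C; [field; now split|].
  transitivity (F z1 / z2 * (z1 / F z1))%C; [field; now split|].
  rewrite E; field; now split. }
assert (Hdd0 := spiral_increment_unique z1 d d0 Hz1 Hz10
  ltac:(now rewrite Hd, Hend) ltac:(now rewrite Hd, Hd0)).
destruct (Ceq_dec d 0) as [Hd00|Hd00].
- rewrite Hd00, Cexp_0 in Hd; rewrite <- Hend, <- Hd; ring.
- exfalso.
  assert (Hlt := spiral_increment_lt z1 d Hz1 Hz10 ltac:(now rewrite Hd, Hend) 0 ltac:(lra) Hd00).
  rewrite Hdd0 in Hlt; unfold d in Hlt; rewrite Cmod_opp in Hlt; lra.
Qed.

End Univalent.

Theorem theorem1p1 (c : nat) :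
  (forall (M : R) (f : C -> C),
     0 < M < M_bound c -> class_S M f -> class_K (bernardi c f)) /\
  (forall f : C -> C, class_S (M_bound c) f -> class_K (bernardi c f)).
Proof.
assert (H : forall (M : R) (f : C -> C),
  0 < M <= M_bound c -> class_S M f -> class_K (bernardi c f)).
{ intros M f HM Hf.
  assert (HMc := M_bound_spec c M HM).
  assert (HM1 : 0 < M <= 1) by (generalize (pos_INR c); nra).
  split; [|split].
  - apply bernardi_H0; now apply class_S_H0 with M.
  - now apply bernardi_univalent with M.
  - intros z Hz; now apply bernardi_convex with M. }
split.
- intros M f HM; apply H; lra.
- intros f; apply H; split; [apply M_bound_pos | lra].
Qed.
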